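(* Let $\Bbbk$ be a commutative ring and let $B$ be a bialgebra over $\Bbbk$. The following are equivalent: (1) $B$ is a Hopf algebra; (2) $-\otimes B:({}_B\mathfrak{M},\otimes,\Bbbk)\to({}_B\mathfrak{M}{}_B^B,\otimes_B,B)$ is a monoidal equivalence of categories; (3) $-\otimes B:{}_B\mathfrak{M}\to{}_B\mathfrak{M}{}_B^B$ is a Frobenius functor; (4) for all $M\in{}_B\mathfrak{M}{}_B^B$ the map $\sigma_M:{}_B\mathrm{Hom}{}_B^B(B\otimes B,M)\to\overline{M}$, $f\mapsto\overline{f(1\otimes 1)}$, is an isomorphism.
   Context: All unadorned tensor products are over the commutative ring $\Bbbk$. For a bialgebra $B$ with comultiplication $\Delta(b)=b_1\otimes b_2$ and counit $\varepsilon$, put $B^+=\ker\varepsilon$. ${}_B\mathfrak{M}$ is the monoidal category of left $B$-modules (tensor product $\otimes$ with diagonal action, unit $\Bbbk$ via $\varepsilon$). ${}_B\mathfrak{M}{}_B^B$ is the category of two-sided Hopf modules: $B$-bimodules $M$ with a coassociative counital right $B$-coaction $\delta:M\to M\otimes B$, $m\mapsto m_0\otimes m_1$, satisfying $\delta(a\cdot m\cdot b)=a_1\cdot m_0\cdot b_1\otimes a_2m_1b_2$; morphisms are the $B$-bilinear and $B$-colinear maps, with Hom-sets denoted ${}_B\mathrm{Hom}{}_B^B(-,-)$. It is monoidal with tensor product $\otimes_B$ (actions $a(m\otimes_Bn)b=am\otimes_Bnb$, coaction $m\otimes_Bn\mapsto m_0\otimes_Bn_0\otimes m_1n_1$) and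 unit $B$. For $V\in{}_B\mathfrak{M}$, $V\otimes B\in{}_B\mathfrak{M}{}_B^B$ via $a\cdot(v\otimes b)\cdot c=a_1v\otimes a_2bc$ and $\delta(v\otimes b)=v\otimes b_1\otimes b_2$; in (4), $B\otimes B$ denotes this object for $V=B$ the left regular module. The functor $-\otimes B$ is strong monoidal via $(V\otimes B)\otimes_B(W\otimes B)\to(V\otimes W)\otimes B$, $(v\otimes a)\otimes_B(w\otimes b)\mapsto v\otimes a_1w\otimes a_2b$, and $B\cong\Bbbk\otimes B$. A monoidal equivalence is a strong monoidal functor which is an equivalence of categories. For $M\in{}_B\mathfrak{M}{}_B^B$, $\overline{M}=M/MB^+$ is a left $B$-module via $b\cdot\overline{m}=\overline{b\cdot m}$, and ${}_B\mathrm{Hom}{}_B^B(B\otimes B,M)$ is a left $B$-module via $(b\cdot f)(x\otimes y)=f(xb\otimes y)$; $\sigma_M$ is left $B$-linear. A functor $\mathcal{F}$ is Frobenius if there exists a functor that is simultaneously a left adjoint and a right adjoint of $\mathcal{F}$. *)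

(* Defs.v *)
From HB Require Import structures.
From mathcomp Require Import all_boot all_algebra.
From mathcomp Require Import boolp.

Set Implicit Arguments.
Unset Strict Implicit.
Unset Printing Implicit Defensive.

Import GRing.Theory.
Local Open Scope ring_scope.
Local Open Scope quotient_scope.

(* sesquilinear.v has bilinear maps over nonzero rings only; here the base
   ring may be trivial. *)
HB.mixin Record isBilin (k : pzRingType) (U V W : lmodType k)
    (f : U -> V -> W) := {
  bilin_l_subproof : forall v, linear (f ^~ v);
  bilin_r_subproof : forall u, linear (f u)
}.
HB.structure Definition Bilin (k : pzRingType) (U V W : lmodType k) :=
  {f of isBilin k U V W f}.
Notation "{ 'bilin' U -> V -> W }" := (Bilin.type U V W)
  (at level 0, U at level 98, V at level 98, W at level 99) : type_scope.

Section BilinTheory.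
Variables (k : pzRingType) (U V W : lmodType k) (f : {bilin U -> V -> W}).

Lemma bilin0l v : f 0 v = 0.
Proof.
have := bilin_l_subproof (s := f) v 1 0 0; rewrite !scale1r !addr0 => h.
by apply: (@addrI _ (f 0 v)); rewrite -h addr0.
Qed.
Lemma bilinDl v u u' : f (u + u') v = f u v + f u' v.
Proof. by have := bilin_l_subproof (s := f) v 1 u u'; rewrite !scale1r. Qed.
Lemma bilinZl v a u : f (a *: u) v = a *: f u v.
Proof.
by have := bilin_l_subproof (s := f) v a u 0; rewrite /= bilin0l !addr0.
Qed.
Lemma bilin0r u : f u 0 = 0.
Proof.
have := bilin_r_subproof (s := f) u 1 0 0; rewrite !scale1r !addr0 => h.
by apply: (@addrI _ (f u 0)); rewrite -h addr0.
Qed.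
Lemma bilinDr u v v' : f u (v + v') = f u v + f u v'.
Proof. by have := bilin_r_subproof (s := f) u 1 v v'; rewrite !scale1r. Qed.
Lemma bilinZr u a v : f u (a *: v) = a *: f u v.
Proof.
by have := bilin_r_subproof (s := f) u a v 0; rewrite /= bilin0r !addr0.
Qed.
Lemma bilinNl v u : f (- u) v = - f u v.
Proof. by rewrite -scaleN1r bilinZl scaleN1r. Qed.
Lemma bilinNr u v : f u (- v) = - f u v.
Proof. by rewrite -scaleN1r bilinZr scaleN1r. Qed.
End BilinTheory.

Definition lin0E := (@linear0, bilin0l, bilin0r, addr0, scaler0).
Definition linDE := (@linearD, bilinDl, bilinDr, scalerDr).

Section Tensor.
Variables (k : comPzRingType) (V W : lmodType k).

(* Finite formal sums of pairs (v, w), modulo the least congruence that makes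
   the pairing balanced and biadditive; classes of sums add by concatenation. *)
Inductive tens_rel : seq (V * W) -> seq (V * W) -> Prop :=
| tens_rel_refl s : tens_rel s s
| tens_rel_sym s t : tens_rel s t -> tens_rel t s
| tens_rel_trans s t u : tens_rel s t -> tens_rel t u -> tens_rel s u
| tens_rel_cat s s' t t' :
    tens_rel s s' -> tens_rel t t' -> tens_rel (s ++ t) (s' ++ t')
| tens_rel_comm s t : tens_rel (s ++ t) (t ++ s)
| tens_rel_0 w : tens_rel [:: (0, w)] [::]
| tens_rel_Dl v v' w : tens_rel [:: (v + v', w)] [:: (v, w); (v', w)]
| tens_rel_Dr v w w' : tens_rel [:: (v, w + w')] [:: (v, w); (v, w')]
| tens_rel_Z a v w : tens_rel [:: (a *: v, w)] [:: (v, a *: w)].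

Lemma tens_equiv_subproof :
  equiv_class_of (fun s t => `[< tens_rel s t >]).
Proof.
split=> [s|s t|t s u].
- exact/asboolP/tens_rel_refl.
- by apply: asbool_equiv_eq; split; apply: tens_rel_sym.
- by move=> /asboolP h /asboolP h'; apply/asboolP/(tens_rel_trans h).
Qed.
Definition tens_equiv := EquivRelPack tens_equiv_subproof.

Definition tensor := {eq_quot tens_equiv}.
HB.instance Definition _ := Choice.on tensor.
HB.instance Definition _ := EqQuotient.on tensor.

Implicit Types (x y z : tensor) (s t : seq (V * W)).

Lemma tens_piP s t : tens_rel s t -> \pi_tensor s = \pi_tensor t.
Proof. by move=> h; apply/eqquotP/asboolP. Qed.
Lemma tens_reprP s : tens_rel (repr (\pi_tensor s)) s.
Proof. by apply/asboolP/(@eqquotP _ _ tensor); rewrite reprK. Qed.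

Definition tens0 : tensor := \pi_tensor [::].
Definition tensadd x y : tensor := \pi_tensor (repr x ++ repr y).
Definition tensscale (a : k) x : tensor :=
  \pi_tensor [seq (a *: p.1, p.2) | p <- repr x].

Lemma tensadd_pi s t :
  tensadd (\pi_tensor s) (\pi_tensor t) = \pi_tensor (s ++ t).
Proof. by apply/tens_piP/tens_rel_cat; apply: tens_reprP. Qed.

Lemma tens_rel_scale a s t : tens_rel s t ->
  tens_rel [seq (a *: p.1, p.2) | p <- s] [seq (a *: p.1, p.2) | p <- t].
Proof.
elim=> {s t} [s|s t _ h|s t u _ h _ h'|s s' t t' _ h _ h'|s t|w|v v' w|v w w'
  |b v w] /=.
- exact: tens_rel_refl.
- exact: tens_rel_sym.
- exact: tens_rel_trans h h'.
- by rewrite !map_cat; apply: tens_rel_cat.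
- by rewrite !map_cat; apply: tens_rel_comm.
- by rewrite scaler0; apply: tens_rel_0.
- by rewrite scalerDr; apply: tens_rel_Dl.
- exact: tens_rel_Dr.
- by rewrite scalerA mulrC -scalerA; apply: tens_rel_Z.
Qed.

Lemma tensscale_pi a s :
  tensscale a (\pi_tensor s) = \pi_tensor [seq (a *: p.1, p.2) | p <- s].
Proof. by apply/tens_piP/tens_rel_scale/tens_reprP. Qed.

Lemma tensind0 (P : tensor -> Prop) :
  (forall s, P (\pi_tensor s)) -> forall x, P x.
Proof. by move=> h x; rewrite -[x]reprK. Qed.

Lemma tensaddA : associative tensadd.
Proof.
elim/tensind0=> x; elim/tensind0=> y; elim/tensind0=> z.
by rewrite !tensadd_pi catA.
Qed.
Lemma tensaddC : commutative tensadd.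
Proof.
elim/tensind0=> x; elim/tensind0=> y; rewrite !tensadd_pi.
exact/tens_piP/tens_rel_comm.
Qed.
Lemma tensadd0 : left_id tens0 tensadd.
Proof. by elim/tensind0=> x; rewrite !tensadd_pi. Qed.

Lemma tens_rel_0seq s : tens_rel [seq (0 *: p.1, p.2) | p <- s] [::].
Proof.
elim: s => [|[v w] s IH] /=; first exact: tens_rel_refl.
rewrite scale0r -cat1s; apply: (tens_rel_cat (s' := [::]) _ IH).
exact: tens_rel_0.
Qed.
Lemma tens_rel_Dseq a b s : tens_rel [seq ((a + b) *: p.1, p.2) | p <- s]
  ([seq (a *: p.1, p.2) | p <- s] ++ [seq (b *: p.1, p.2) | p <- s]).
Proof.
elim: s => [|[v w] s IH] /=; first exact: tens_rel_refl.
rewrite scalerDl -cat1s.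
apply: (tens_rel_trans (tens_rel_cat (tens_rel_Dl _ _ _) IH)) => /=.
have := tens_rel_cat (tens_rel_refl [:: (a *: v, w)]) (tens_rel_cat
  (tens_rel_comm [:: (b *: v, w)] [seq (a *: p.1, p.2) | p <- s])
  (tens_rel_refl [seq (b *: p.1, p.2) | p <- s])).
by rewrite -!catA.
Qed.

Lemma tensscale0 x : tensscale 0 x = tens0.
Proof.
elim/tensind0: x => s; rewrite tensscale_pi.
exact/tens_piP/tens_rel_0seq.
Qed.
Lemma tensscaleDl x a b :
  tensscale (a + b) x = tensadd (tensscale a x) (tensscale b x).
Proof.
elim/tensind0: x => s; rewrite !tensscale_pi tensadd_pi.
exact/tens_piP/tens_rel_Dseq.
Qed.
Lemma tensscale1 : left_id 1 tensscale.
Proof.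
elim/tensind0=> s; rewrite tensscale_pi; congr (\pi_tensor _).
by elim: s => [|[v w] s IH] //=; rewrite scale1r IH.
Qed.
Lemma tensscaleA a b x : tensscale a (tensscale b x) = tensscale (a * b) x.
Proof.
elim/tensind0: x => s; rewrite !tensscale_pi -map_comp; congr (\pi_tensor _).
by apply: eq_map => -[v w] /=; rewrite scalerA.
Qed.
Lemma tensscaleDr a : {morph tensscale a : x y / tensadd x y}.
Proof.
elim/tensind0=> s; elim/tensind0=> t.
by rewrite tensadd_pi !tensscale_pi tensadd_pi map_cat.
Qed.
Lemma tensaddN : left_inverse tens0 (tensscale (-1)) tensadd.
Proof.
move=> x; rewrite -[X in tensadd _ X]tensscale1 -tensscaleDl addNr.
exact: tensscale0.
Qed.

HB.instance Definition _ :=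
  GRing.isZmodule.Build tensor tensaddA tensaddC tensadd0 tensaddN.
HB.instance Definition _ :=
  GRing.Zmodule_isLmodule.Build k tensor tensscaleA tensscale1
    (fun a x y => tensscaleDr a x y) tensscaleDl.

Lemma tensor_addE x y : x + y = tensadd x y. Proof. by []. Qed.
Lemma tensor_scaleE a x : a *: x = tensscale a x. Proof. by []. Qed.

Definition tens (v : V) (w : W) : tensor := \pi_tensor [:: (v, w)].

Lemma tens_bilinl w : linear (tens ^~ w).
Proof.
move=> a v v'; rewrite tensor_addE tensor_scaleE.
rewrite tensscale_pi tensadd_pi; apply: tens_piP; exact: tens_rel_Dl.
Qed.
Lemma tens_bilinr v : linear (tens v).
Proof.
move=> a w w'; rewrite tensor_addE tensor_scaleE.
rewrite tensscale_pi tensadd_pi; apply: tens_piP => /=.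
apply: tens_rel_trans (tens_rel_Dr _ _ _) _.
rewrite -cat1s -[X in tens_rel _ X]cat1s.
by apply: tens_rel_cat; [apply/tens_rel_sym/tens_rel_Z|exact: tens_rel_refl].
Qed.
HB.instance Definition _ := isBilin.Build k V W tensor tens
  tens_bilinl tens_bilinr.

Lemma tens_ind (P : tensor -> Prop) :
  P 0 -> (forall v w, P (tens v w)) -> (forall x y, P x -> P y -> P (x + y)) ->
  forall x, P x.
Proof.
move=> P0 Pt PD; elim/tensind0; elim=> [//|[v w] s IH].
have -> : \pi_tensor ((v, w) :: s) = tens v w + \pi_tensor s.
  by rewrite tensor_addE tensadd_pi.
exact: PD.
Qed.

Section Lift.
Variables (U : lmodType k) (f : {bilin V -> W -> U}).
Definition tlift (x : tensor) : U := \sum_(p <- repr x) f p.1 p.2.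

Lemma tlift_pi s : tlift (\pi_tensor s) = \sum_(p <- s) f p.1 p.2.
Proof.
rewrite /tlift; move: (tens_reprP s); move: (repr _) => t.
elim=> {s t} [s|s t _ h|s t u _ h _ h'|s s' t t' _ h _ h'|s t|w|v v' w|v w w'
  |b v w] //=.
- by rewrite h.
- by rewrite !big_cat /= h h'.
- by rewrite !big_cat /= addrC.
- by rewrite big_cons !big_nil addr0 bilin0l.
- by rewrite !big_cons !big_nil !addr0 bilinDl.
- by rewrite !big_cons !big_nil !addr0 bilinDr.
- by rewrite !big_cons !big_nil !addr0 bilinZl bilinZr.
Qed.

Lemma tliftE v w : tlift (tens v w) = f v w.
Proof. by rewrite tlift_pi big_seq1. Qed.

Lemma tlift_linear : linear tlift.
Proof.
move=> a; elim/tensind0=> s; elim/tensind0=> t.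
rewrite tensor_addE tensor_scaleE tensscale_pi tensadd_pi !tlift_pi.
rewrite big_cat big_map scaler_sumr /=; congr (_ + _).
by apply: eq_bigr => p _; rewrite bilinZl.
Qed.
HB.instance Definition _ := GRing.isLinear.Build k tensor U _ tlift tlift_linear.
End Lift.

End Tensor.
Arguments tens {k V W} v w.
Arguments tensor {k} V%_type W%_type.

Notation "V ⊗ W" := (tensor V%type W%type)
  (at level 40, left associativity) : type_scope.
Notation "v ⊗ w" := (tens v w) (at level 40, left associativity) : ring_scope.

Ltac tens_elim x :=
  elim/tens_ind: x;
  [by rewrite !lin0E | | by move=> ? ?; rewrite !linDE /= => -> ->].

Section TensorMaps.
Variable k : comPzRingType.

Lemma mk_linear (U V : lmodType k) (f : U -> V) :
  {morph f : x y / x + y} -> (forall a, {morph f : x / a *: x}) -> linear f.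
Proof. by move=> fD fZ a x y; rewrite fD fZ. Qed.

Section Map.
Variables (V W V' W' : lmodType k).
Variables (f : {linear V -> V'}) (g : {linear W -> W'}).

Definition tmap_pure v w : V' ⊗ W' := f v ⊗ g w.
Lemma tmap_pure_l w : linear (tmap_pure ^~ w).
Proof. by move=> a x y; rewrite /tmap_pure linearP bilinDl bilinZl. Qed.
Lemma tmap_pure_r v : linear (tmap_pure v).
Proof. by move=> a x y; rewrite /tmap_pure linearP bilinDr bilinZr. Qed.
HB.instance Definition _ :=
  isBilin.Build k V W (V' ⊗ W')%type tmap_pure tmap_pure_l tmap_pure_r.

Definition tmap : V ⊗ W -> V' ⊗ W' := tlift tmap_pure.
HB.instance Definition _ := GRing.Linear.on tmap.
Lemma tmapE v w : tmap (v ⊗ w) = f v ⊗ g w.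
Proof. exact: tliftE. Qed.
End Map.

Section Bil.
Variables (A A' V W V' W' : lmodType k).
Variables (f : {bilin A -> V -> V'}) (g : {bilin A' -> W -> W'}).

Section Pure.
Variables (a : A) (a' : A').
Definition tbil_pure v w : V' ⊗ W' := f a v ⊗ g a' w.
Lemma tbil_pure_l w : linear (tbil_pure ^~ w).
Proof. by move=> c x y; rewrite /tbil_pure !(bilinDl,bilinZl,bilinDr,bilinZr). Qed.
Lemma tbil_pure_r v : linear (tbil_pure v).
Proof. by move=> c x y; rewrite /tbil_pure !(bilinDr,bilinZr). Qed.
HB.instance Definition _ :=
  isBilin.Build k V W (V' ⊗ W')%type tbil_pure tbil_pure_l tbil_pure_r.
End Pure.

Definition tbil_left y a a' : V' ⊗ W' := tlift (tbil_pure a a') y.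
Lemma tbil_left_l y a' : linear (tbil_left y ^~ a').
Proof.
move=> c a b; rewrite /tbil_left; elim/tens_ind: y => [|v w|x y IH IH'].
- by rewrite !lin0E.
- by rewrite !tliftE /= /tbil_pure !(bilinDl,bilinZl).
- by rewrite !linearD /= IH IH' addrACA.
Qed.
Lemma tbil_left_r y a : linear (tbil_left y a).
Proof.
move=> c a' b; rewrite /tbil_left; elim/tens_ind: y => [|v w|x y IH IH'].
- by rewrite !lin0E.
- by rewrite !tliftE /= /tbil_pure !(bilinDl,bilinZl,bilinDr,bilinZr).
- by rewrite !linearD /= IH IH' addrACA.
Qed.
HB.instance Definition _ y :=
  isBilin.Build k A A' (V' ⊗ W')%type (tbil_left y)
    (tbil_left_l y) (tbil_left_r y).

(* The bilinear map with (a ⊗ a', v ⊗ w) |-> f a v ⊗ g a' w *)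
Definition tbil (x : A ⊗ A') (y : V ⊗ W) : V' ⊗ W' := tlift (tbil_left y) x.
Lemma tbil_l y : linear (tbil ^~ y).
Proof. by move=> c x x'; rewrite /tbil linearP. Qed.
Lemma tbil_r x : linear (tbil x).
Proof.
move=> c y y'; rewrite /tbil; elim/tens_ind: x => [|a a'|x x' IH IH'].
- by rewrite !lin0E.
- by rewrite !tliftE /= /tbil_left linearP.
- by rewrite !linearD /= IH IH' addrACA.
Qed.
HB.instance Definition _ := isBilin.Build k (A ⊗ A')%type (V ⊗ W)%type
  (V' ⊗ W')%type tbil tbil_l tbil_r.

Lemma tbilE a a' v w : tbil (a ⊗ a') (v ⊗ w) = f a v ⊗ g a' w.
Proof. by rewrite /tbil tliftE /= /tbil_left tliftE. Qed.
End Bil.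


Section Assoc.
Variables (U V W : lmodType k).

Definition tensr (w : W) (v : V) : V ⊗ W := v ⊗ w.
HB.instance Definition _ w :=
  GRing.isLinear.Build k V (V ⊗ W)%type _ (tensr w)
    (bilin_l_subproof (s := @tens k V W) w).
Definition tensl (v : V) (w : W) : V ⊗ W := v ⊗ w.
HB.instance Definition _ v :=
  GRing.isLinear.Build k W (V ⊗ W)%type _ (tensl v)
    (bilin_r_subproof (s := @tens k V W) v).
End Assoc.

Section Assoc.
Variables (U V W : lmodType k).

Definition tassoc_pure (x : U ⊗ V) (w : W) : U ⊗ (V ⊗ W) :=
  tmap idfun (tensr w) x.
Lemma tassoc_pure_l w : linear (tassoc_pure ^~ w).
Proof. by move=> c x x'; rewrite /tassoc_pure linearP. Qed.
Lemma tassoc_pure_r x : linear (tassoc_pure x).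
Proof.
move=> c w w'; rewrite /tassoc_pure; elim/tens_ind: x => [|u v|x y IH IH'].
- by rewrite !lin0E.
- by rewrite !tmapE /= /tensr !(bilinDr,bilinZr).
- by rewrite !linearD /= IH IH' addrACA.
Qed.
HB.instance Definition _ :=
  isBilin.Build k (U ⊗ V)%type W (U ⊗ (V ⊗ W))%type
    tassoc_pure tassoc_pure_l tassoc_pure_r.
Definition tassoc : U ⊗ V ⊗ W -> U ⊗ (V ⊗ W) := tlift tassoc_pure.
HB.instance Definition _ := GRing.Linear.on tassoc.
Lemma tassocE u v w : tassoc (u ⊗ v ⊗ w) = u ⊗ (v ⊗ w).
Proof. by rewrite /tassoc tliftE /= /tassoc_pure tmapE. Qed.

Definition tassocV_pure (u : U) (x : V ⊗ W) : U ⊗ V ⊗ W :=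
  tmap (tensl u) idfun x.
Lemma tassocV_pure_r u : linear (tassocV_pure u).
Proof. by move=> c x x'; rewrite /tassocV_pure linearP. Qed.
Lemma tassocV_pure_l x : linear (tassocV_pure ^~ x).
Proof.
move=> c w w'; rewrite /tassocV_pure; elim/tens_ind: x => [|u v|x y IH IH'].
- by rewrite !lin0E.
- by rewrite !tmapE /= /tensl !(bilinDl,bilinZl).
- by rewrite !linearD /= IH IH' addrACA.
Qed.
HB.instance Definition _ :=
  isBilin.Build k U (V ⊗ W)%type (U ⊗ V ⊗ W)%type
    tassocV_pure tassocV_pure_l tassocV_pure_r.
Definition tassocV : U ⊗ (V ⊗ W) -> U ⊗ V ⊗ W := tlift tassocV_pure.
HB.instance Definition _ := GRing.Linear.on tassocV.
Lemma tassocVE u v w : tassocV (u ⊗ (v ⊗ w)) = u ⊗ v ⊗ w.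
Proof. by rewrite /tassocV tliftE /= /tassocV_pure tmapE. Qed.

Lemma tassocK : cancel tassoc tassocV.
Proof.
move=> x; tens_elim x => x w; tens_elim x => u v.
by rewrite tassocE tassocVE.
Qed.
Lemma tassocVK : cancel tassocV tassoc.
Proof.
move=> x; tens_elim x => u x; tens_elim x => v w.
by rewrite tassocVE tassocE.
Qed.
End Assoc.


Ltac tsimp := repeat progress rewrite ?(tmapE, tbilE, tassocE, tassocVE) /=.
Section Id.
Variables V W : lmodType k.
Lemma tmap_id : tmap (@idfun V) (@idfun W) =1 id.
Proof. by move=> x; tens_elim x => v w; rewrite tmapE. Qed.
End Id.

Lemma tmap_comp (V V' V'' W W' W'' : lmodType k) (f : {linear V' -> V''})
  (f' : {linear V -> V'}) (g : {linear W' -> W''}) (g' : {linear W -> W'}) x :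
  tmap f g (tmap f' g' x) = tmap (f \o f') (g \o g') x.
Proof. by tens_elim x => v w; rewrite !tmapE. Qed.

Lemma eq_tmap (V V' W W' : lmodType k) (f f' : {linear V -> V'})
  (g g' : {linear W -> W'}) : f =1 f' -> g =1 g' -> tmap f g =1 tmap f' g'.
Proof. by move=> e e' x; tens_elim x => v w; rewrite !tmapE e e'. Qed.

Lemma tassoc_nat (U U' V V' W W' : lmodType k) (f : {linear U -> U'})
  (g : {linear V -> V'}) (h : {linear W -> W'}) x :
  tassoc (tmap (tmap f g) h x) = tmap f (tmap g h) (tassoc x).
Proof.
by tens_elim x => x w; tens_elim x => u v; tsimp.
Qed.
Lemma tassocV_nat (U U' V V' W W' : lmodType k) (f : {linear U -> U'})
  (g : {linear V -> V'}) (h : {linear W -> W'}) x :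
  tassocV (tmap f (tmap g h) x) = tmap (tmap f g) h (tassocV x).
Proof.
by apply: (can_inj (@tassocK _ _ _)); rewrite tassoc_nat !tassocVK.
Qed.

Lemma eq_tbil (A A' V V' W W' : lmodType k)
  (f f' : {bilin A -> V -> V'}) (g g' : {bilin A' -> W -> W'}) :
  f =2 f' -> g =2 g' -> tbil f g =2 tbil f' g'.
Proof.
move=> e e' x y; tens_elim x => a a'; tens_elim y => v w.
by tsimp; rewrite e e'.
Qed.

Lemma tbil_assoc (A A' C C' V V' X X' Y Y' Z Z' : lmodType k)
  (f : {bilin X -> V -> Z}) (f' : {bilin X' -> V' -> Z'})
  (h : {bilin A -> C -> X}) (h' : {bilin A' -> C' -> X'})
  (g : {bilin A -> Y -> Z}) (g' : {bilin A' -> Y' -> Z'})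
  (l : {bilin C -> V -> Y}) (l' : {bilin C' -> V' -> Y'}) :
  (forall a c v, f (h a c) v = g a (l c v)) ->
  (forall a c v, f' (h' a c) v = g' a (l' c v)) ->
  forall x y z, tbil f f' (tbil h h' x y) z = tbil g g' x (tbil l l' y z).
Proof.
move=> e e' x y z; tens_elim x => a a'; tens_elim y => c c'.
by tens_elim z => v v'; tsimp; rewrite e e'.
Qed.

Lemma tmap_tbil (A A' V V' W W' A1 A1' V1 V1' W1 W1' : lmodType k)
  (f : {bilin A -> V -> W}) (f' : {bilin A' -> V' -> W'})
  (g : {bilin A1 -> V1 -> W1}) (g' : {bilin A1' -> V1' -> W1'})
  (a : {linear A -> A1}) (a' : {linear A' -> A1'})
  (v : {linear V -> V1}) (v' : {linear V' -> V1'})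
  (w : {linear W -> W1}) (w' : {linear W' -> W1'}) :
  (forall x y, w (f x y) = g (a x) (v y)) ->
  (forall x y, w' (f' x y) = g' (a' x) (v' y)) ->
  forall x y, tmap w w' (tbil f f' x y) = tbil g g' (tmap a a' x) (tmap v v' y).
Proof.
move=> e e' x y; tens_elim x => b b'; tens_elim y => c c'.
by tsimp; rewrite e e'.
Qed.

Lemma tassoc_tbil (A A' A'' V V' V'' W W' W'' : lmodType k)
  (f : {bilin A -> V -> W}) (f' : {bilin A' -> V' -> W'})
  (f'' : {bilin A'' -> V'' -> W''}) x y :
  tassoc (tbil (tbil f f') f'' x y) =
  tbil f (tbil f' f'') (tassoc x) (tassoc y).
Proof.
tens_elim x => x a''; tens_elim x => a a'.
tens_elim y => y v''; tens_elim y => v v'.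
by tsimp.
Qed.
Lemma tassocV_tbil (A A' A'' V V' V'' W W' W'' : lmodType k)
  (f : {bilin A -> V -> W}) (f' : {bilin A' -> V' -> W'})
  (f'' : {bilin A'' -> V'' -> W''}) x y :
  tassocV (tbil f (tbil f' f'') x y) =
  tbil (tbil f f') f'' (tassocV x) (tassocV y).
Proof.
by apply: (can_inj (@tassocK _ _ _)); rewrite tassoc_tbil !tassocVK.
Qed.
End TensorMaps.
Arguments tassoc {k U V W} x.
Arguments tassocV {k U V W} x.

Section Ext.
Variables (k : comPzRingType).

Lemma tens_ext2 (V W X : lmodType k) (f g : {linear (V ⊗ W)%type -> X}) :
  (forall v w, f (v ⊗ w) = g (v ⊗ w)) -> f =1 g.
Proof. by move=> e x; tens_elim x. Qed.

Lemma tens_ext3 (U V W X : lmodType k) (f g : {linear (U ⊗ V ⊗ W)%type -> X}) :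
  (forall u v w, f (u ⊗ v ⊗ w) = g (u ⊗ v ⊗ w)) -> f =1 g.
Proof. by move=> e x; tens_elim x => x w; tens_elim x. Qed.

Lemma tens_ext4 (U V W Z X : lmodType k)
  (f g : {linear (U ⊗ V ⊗ W ⊗ Z)%type -> X}) :
  (forall u v w z, f (u ⊗ v ⊗ w ⊗ z) = g (u ⊗ v ⊗ w ⊗ z)) -> f =1 g.
Proof. by move=> e x; tens_elim x => x z; tens_elim x => x w; tens_elim x. Qed.
End Ext.

Section QuotientModule.
Variables (k : pzRingType) (V : lmodType k) (G : V -> Prop).

Inductive span : V -> Prop :=
| span_0 : span 0
| span_lin a x y : G x -> span y -> span (a *: x + y).

Lemma spanD x y : span x -> span y -> span (x + y).
Proof.
elim=> [|a {}x z gx _ IH] sy; first by rewrite add0r.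
by rewrite -addrA; apply: span_lin => //; apply: IH.
Qed.
Lemma spanZ a x : span x -> span (a *: x).
Proof.
elim=> [|b {}x z gx _ IH]; first by rewrite scaler0; apply: span_0.
by rewrite scalerDr scalerA; apply: span_lin.
Qed.
Lemma spanN x : span x -> span (- x).
Proof. by rewrite -scaleN1r; apply: spanZ. Qed.
Lemma span_gen x : G x -> span x.
Proof.
by move=> gx; rewrite -[x]addr0 -[x]scale1r; apply: span_lin => //; apply: span_0.
Qed.

Lemma quot_equiv_subproof :
  equiv_class_of (fun x y => `[< span (x - y) >]).
Proof.
split=> [x|x y|y x z].
- by apply/asboolP; rewrite subrr; apply: span_0.
- by apply: asbool_equiv_eq; split=> /spanN; rewrite opprB.
- move=> /asboolP h /asboolP h'; apply/asboolP.
  by rewrite -(subrKA y); apply: spanD.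
Qed.
Definition quot_equiv := EquivRelPack quot_equiv_subproof.

Definition quot := {eq_quot quot_equiv}.
HB.instance Definition _ := Choice.on quot.
HB.instance Definition _ := EqQuotient.on quot.

Definition qpi (x : V) : quot := \pi_quot x.
Lemma qpiP x y : span (x - y) <-> qpi x = qpi y.
Proof.
by split=> [h|/(@eqquotP _ _ quot)/asboolP //]; apply/(@eqquotP _ _ quot)/asboolP.
Qed.
Lemma quot_ind (P : quot -> Prop) : (forall x, P (qpi x)) -> forall q, P q.
Proof. by move=> h q; rewrite -[q]reprK. Qed.
Lemma qpi_repr x : span (repr (qpi x) - x).
Proof. by apply/qpiP; rewrite /qpi reprK. Qed.

Definition qadd (p q : quot) : quot := qpi (repr p + repr q).
Definition qopp (p : quot) : quot := qpi (- repr p).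
Definition qscale a (p : quot) : quot := qpi (a *: repr p).
Lemma qadd_pi x y : qadd (qpi x) (qpi y) = qpi (x + y).
Proof. by apply/qpiP; rewrite opprD addrACA; apply: spanD; apply: qpi_repr. Qed.
Lemma qopp_pi x : qopp (qpi x) = qpi (- x).
Proof. by apply/qpiP; rewrite -opprD; apply/spanN/qpi_repr. Qed.
Lemma qscale_pi a x : qscale a (qpi x) = qpi (a *: x).
Proof. by apply/qpiP; rewrite -scalerBr; apply/spanZ/qpi_repr. Qed.

Lemma qaddA : associative qadd.
Proof.
elim/quot_ind=> x; elim/quot_ind=> y; elim/quot_ind=> z.
by rewrite (qadd_pi x) (qadd_pi y) !qadd_pi addrA.
Qed.
Lemma qaddC : commutative qadd.
Proof.
by elim/quot_ind=> x; elim/quot_ind=> y; rewrite (qadd_pi x) qadd_pi addrC.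
Qed.
Lemma qadd0 : left_id (qpi 0) qadd.
Proof. by elim/quot_ind=> x; rewrite qadd_pi add0r. Qed.
Lemma qaddN : left_inverse (qpi 0) qopp qadd.
Proof. by elim/quot_ind=> x; rewrite qopp_pi qadd_pi addNr. Qed.
HB.instance Definition _ := GRing.isZmodule.Build quot qaddA qaddC qadd0 qaddN.

Lemma qscaleA a b q : qscale a (qscale b q) = qscale (a * b) q.
Proof. by elim/quot_ind: q => x; rewrite (qscale_pi b) !qscale_pi scalerA. Qed.
Lemma qscale1 : left_id 1 qscale.
Proof. by elim/quot_ind=> x; rewrite qscale_pi scale1r. Qed.
Lemma qscaleDr : right_distributive qscale +%R.
Proof.
move=> a; elim/quot_ind=> x; elim/quot_ind=> y; rewrite [LHS]/qscale.
change (qscale a (qadd (qpi x) (qpi y)) =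
        qadd (qscale a (qpi x)) (qscale a (qpi y))).
by rewrite (qadd_pi x) (qscale_pi a (x + y)) !(qscale_pi a) qadd_pi scalerDr.
Qed.
Lemma qscaleDl q : {morph qscale^~ q : a b / a + b}.
Proof.
elim/quot_ind: q => x a b.
change (qscale (a + b) (qpi x) = qadd (qscale a (qpi x)) (qscale b (qpi x))).
by rewrite !qscale_pi qadd_pi scalerDl.
Qed.
HB.instance Definition _ :=
  GRing.Zmodule_isLmodule.Build k quot qscaleA qscale1 qscaleDr qscaleDl.

Lemma qpi_linear : linear qpi.
Proof.
move=> a x y; change (qpi (a *: x + y) = qadd (qscale a (qpi x)) (qpi y)).
by rewrite qscale_pi qadd_pi.
Qed.
HB.instance Definition _ := GRing.isLinear.Build k V quot _ qpi qpi_linear.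

Lemma qpi_eq0 x : G x -> qpi x = 0.
Proof. by move=> gx; apply/qpiP; rewrite subr0; apply: span_gen. Qed.

Section Lift.
Variables (U : lmodType k) (f : {linear V -> U}).
Hypothesis fG : forall x, G x -> f x = 0.

Lemma span_ker x : span x -> f x = 0.
Proof.
elim=> [|a {}x y gx _ IH]; first exact: linear0.
by rewrite linearP fG // scaler0 IH addr0.
Qed.
End Lift.

Definition qlift (U : lmodType k) (f : {linear V -> U})
  (fG : forall x, G x -> f x = 0) (q : quot) : U := f (repr q).
Lemma qliftE (U : lmodType k) (f : {linear V -> U})
  (fG : forall x, G x -> f x = 0) x : qlift fG (qpi x) = f x.
Proof.
by apply/eqP; rewrite -subr_eq0 -linearB (span_ker fG) //; apply: qpi_repr.
Qed.
Section LiftLinear.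
Variables (U : lmodType k) (f : {linear V -> U}).
Variable fG : forall x, G x -> f x = 0.
Lemma qlift_linear : linear (qlift fG).
Proof.
by move=> a; elim/quot_ind=> x; elim/quot_ind=> y;
  rewrite -linearP !qliftE linearP.
Qed.
HB.instance Definition _ := GRing.isLinear.Build k quot U _
  (qlift fG) qlift_linear.
End LiftLinear.
End QuotientModule.

Section Scal.
Variables (k : comPzRingType) (V : lmodType k).

Definition lscal (a : k^o) (v : V) : V := a *: v.
Lemma lscal_l v : linear (lscal ^~ v).
Proof. by move=> c x y; rewrite /lscal scalerDl scalerA. Qed.
Lemma lscal_r a : linear (lscal a).
Proof. by move=> c x y; rewrite /lscal linearP. Qed.
HB.instance Definition _ := isBilin.Build k k^o V V lscal lscal_l lscal_r.
Definition tlunit : k^o ⊗ V -> V := tlift lscal.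
HB.instance Definition _ := GRing.Linear.on tlunit.
Lemma tlunitE a v : tlunit (a ⊗ v) = (a : k) *: v.
Proof. by rewrite /tlunit tliftE. Qed.

Definition rscal (v : V) (a : k^o) : V := (a : k) *: v.
HB.instance Definition _ := isBilin.Build k V k^o V rscal lscal_r lscal_l.
Definition trunit : V ⊗ k^o -> V := tlift rscal.
HB.instance Definition _ := GRing.Linear.on trunit.
Lemma trunitE a v : trunit (v ⊗ a) = (a : k) *: v.
Proof. by rewrite /trunit tliftE. Qed.
End Scal.
Arguments tlunit {k V} x.
Arguments trunit {k V} x.

Ltac tsimp :=
  repeat progress rewrite ?(tmapE, tbilE, tassocE, tassocVE, tlunitE, trunitE) /=.

Section BilinOps.
Variable k : comPzRingType.

Lemma linear_ext (U V : lmodType k) (f g : {linear U -> V}) : f =1 g -> f = g.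
Proof.
case: f g => [f cf] [g cg] /= /funext e; move: e cf cg => -> cf cg.
congr (GRing.Linear.Pack _).
destruct cf as [[p] [q]], cg as [[p'] [q']].
by rewrite (Prop_irrelevance p p') (Prop_irrelevance q q').
Qed.

Section Pre.
Variables (A C V W : lmodType k) (f : {bilin A -> V -> W}) (h : {linear C -> A}).
Definition bilpre (c : C) (v : V) : W := f (h c) v.
Lemma bilpre_l v : linear (bilpre ^~ v).
Proof. by move=> a x y; rewrite /bilpre linearP bilinDl bilinZl. Qed.
Lemma bilpre_r c : linear (bilpre c).
Proof. by move=> a x y; rewrite /bilpre bilinDr bilinZr. Qed.
HB.instance Definition _ := isBilin.Build k C V W bilpre bilpre_l bilpre_r.
End Pre.

Section InRight.
Variables (C V W W' : lmodType k) (g : {bilin W -> C -> W'}).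
Definition bilflip (c : C) (w : W) : W' := g w c.
HB.instance Definition _ c :=
  GRing.isLinear.Build k W W' _ (bilflip c) (bilin_l_subproof (s := g) c).
Definition bilinr (x : V ⊗ W) (c : C) : V ⊗ W' := tmap idfun (bilflip c) x.
Lemma bilinr_l c : linear (bilinr ^~ c).
Proof. by move=> a x y; rewrite /bilinr linearP. Qed.
Lemma bilinr_r x : linear (bilinr x).
Proof.
move=> a c d; rewrite /bilinr; elim/tens_ind: x => [|v w|x y IH IH'].
- by rewrite !lin0E.
- by tsimp; rewrite /bilflip !(bilinDr,bilinZr).
- by rewrite !linearD /= IH IH' addrACA.
Qed.
HB.instance Definition _ := isBilin.Build k (V ⊗ W)%type C (V ⊗ W')%type
  bilinr bilinr_l bilinr_r.
Lemma bilinrE v w c : bilinr (v ⊗ w) c = v ⊗ g w c.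
Proof. by rewrite /bilinr tmapE. Qed.
End InRight.

Lemma tassocV_bilinr (V W C W' D X Y : lmodType k)
  (g : {bilin W -> C -> W'}) (h : {bilin D -> X -> Y}) (v : V) t u :
  tassocV (v ⊗ tbil g h t u) = tbil (bilinr g) h (tassocV (v ⊗ t)) u.
Proof.
by tens_elim t => w d; tens_elim u => c x; tsimp; rewrite bilinrE.
Qed.

Lemma tbil_pre (A C V W A' V' W' : lmodType k) (f : {bilin A' -> V' -> W'})
  (g : {bilin A -> V -> W}) (h : {linear C -> A}) x y :
  tbil f (bilpre g h) x y = tbil f g (tmap idfun h x) y.
Proof. by tens_elim x => a c; tens_elim y => v w; tsimp. Qed.
Lemma tbil_prel (A C V W A' V' W' : lmodType k) (f : {bilin A' -> V' -> W'})
  (g : {bilin A -> V -> W}) (h : {linear C -> A}) x y :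
  tbil (bilpre g h) f x y = tbil g f (tmap h idfun x) y.
Proof. by tens_elim x => a c; tens_elim y => v w; tsimp. Qed.
End BilinOps.

Record category := Category {
  obj :> Type;
  hom : obj -> obj -> Type;
  idm : forall a, hom a a;
  comp : forall a b c, hom b c -> hom a b -> hom a c;
  compidl : forall a b (f : hom a b), comp (idm b) f = f;
  compidr : forall a b (f : hom a b), comp f (idm a) = f;
  compA : forall a b c d (f : hom c d) (g : hom b c) (h : hom a b),
    comp f (comp g h) = comp (comp f g) h
}.
Arguments hom {c} : rename.
Arguments idm {c} a : rename.

Definition is_iso (C : category) (a b : C) (f : hom a b) : Prop :=
  exists g : hom b a, comp g f = idm a /\ comp f g = idm b.

Record functor (C D : category) := Functor {
  fobj :> C -> D;
  fmap : forall a b, hom a b -> hom (fobj a) (fobj b);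
  fmap_id : forall a, fmap (idm a) = idm (fobj a);
  fmap_comp : forall a b c (f : hom b c) (g : hom a b),
    fmap (comp f g) = comp (fmap f) (fmap g)
}.
Arguments fmap {C D} f {a b} : rename.

Definition idF (C : category) : functor C C :=
  @Functor C C id (fun a b f => f) (fun a => erefl) (fun a b c f g => erefl).

Section CompF.
Variables (C D E : category) (G : functor D E) (F : functor C D).
Lemma compF_id a : fmap G (fmap F (idm a)) = idm (G (F a)).
Proof. by rewrite !fmap_id. Qed.
Lemma compF_comp a b c (f : hom b c) (g : hom a b) :
  fmap G (fmap F (comp f g)) = comp (fmap G (fmap F f)) (fmap G (fmap F g)).
Proof. by rewrite !fmap_comp. Qed.
Definition compF : functor C E := Functor compF_id compF_comp.
End CompF.

Definition natural (C D : category) (F G : functor C D)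
    (t : forall a, hom (F a) (G a)) : Prop :=
  forall a b (f : hom a b), comp (t b) (fmap F f) = comp (fmap G f) (t a).

Definition nat_iso (C D : category) (F G : functor C D) : Prop :=
  exists t : forall a, hom (F a) (G a), natural t /\ forall a, is_iso (t a).

Definition is_equivalence (C D : category) (F : functor C D) : Prop :=
  exists G : functor D C,
    nat_iso (compF G F) (idF C) /\ nat_iso (compF F G) (idF D).

Definition adjoint (C D : category) (L : functor C D) (R : functor D C) : Prop :=
  exists (eta : forall a, hom (idF C a) (compF R L a))
         (eps : forall b, hom (compF L R b) (idF D b)),
  [/\ natural eta, natural eps,
      forall a, comp (eps (L a)) (fmap L (eta a)) = idm (L a) &
      forall b, comp (fmap R (eps b)) (eta (R b)) = idm (R b)].

Definition is_frobenius (C D : category) (F : functor C D) : Prop :=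
  exists G : functor D C, adjoint G F /\ adjoint F G.

Record monoidal_category := MonoidalCategory {
  mcat :> category;
  munit : mcat;
  mtens : mcat -> mcat -> mcat;
  mtensh : forall a a' b b',
    hom a a' -> hom b b' -> hom (mtens a b) (mtens a' b');
  massoc : forall a b c, hom (mtens (mtens a b) c) (mtens a (mtens b c));
  mlunit : forall a, hom (mtens munit a) a;
  mrunit : forall a, hom (mtens a munit) a;
  mtensh_id : forall a b, mtensh (idm a) (idm b) = idm (mtens a b);
  mtensh_comp : forall a a' a'' b b' b'' (f : hom a' a'') (f' : hom a a')
    (g : hom b' b'') (g' : hom b b'),
    mtensh (comp f f') (comp g g') = comp (mtensh f g) (mtensh f' g');
  massoc_iso : forall a b c, is_iso (massoc a b c);
  mlunit_iso : forall a, is_iso (mlunit a);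
  mrunit_iso : forall a, is_iso (mrunit a);
  massoc_nat : forall a a' b b' c c'
    (f : hom a a') (g : hom b b') (h : hom c c'),
    comp (massoc a' b' c') (mtensh (mtensh f g) h) =
    comp (mtensh f (mtensh g h)) (massoc a b c);
  mlunit_nat : forall a b (f : hom a b),
    comp (mlunit b) (mtensh (idm munit) f) = comp f (mlunit a);
  mrunit_nat : forall a b (f : hom a b),
    comp (mrunit b) (mtensh f (idm munit)) = comp f (mrunit a);
  mpentagon : forall a b c d,
    comp (massoc a b (mtens c d)) (massoc (mtens a b) c d) =
    comp (mtensh (idm a) (massoc b c d))
      (comp (massoc a (mtens b c) d) (mtensh (massoc a b c) (idm d)));
  mtriangle : forall a b,
    comp (mtensh (idm a) (mlunit b)) (massoc a munit b) =
    mtensh (mrunit a) (idm b)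
}.
Arguments munit {m} : rename.
Arguments mtens {m} a b : rename.
Arguments mtensh {m a a' b b'} f g : rename.
Arguments massoc {m} a b c : rename.
Arguments mlunit {m} a : rename.
Arguments mrunit {m} a : rename.

Record strong_monoidal (C D : monoidal_category) (F : functor C D)
    (phi : forall a b, hom (mtens (F a) (F b)) (F (mtens a b)))
    (phi0 : hom munit (F munit)) : Prop := StrongMonoidal {
  strong_iso : forall a b, is_iso (phi a b);
  strong_iso0 : is_iso phi0;
  strong_nat : forall a a' b b' (f : hom a a') (g : hom b b'),
    comp (phi a' b') (mtensh (fmap F f) (fmap F g)) =
    comp (fmap F (mtensh f g)) (phi a b);
  strong_assoc : forall a b c,
    comp (fmap F (massoc a b c))
      (comp (phi (mtens a b) c) (mtensh (phi a b) (idm (F c)))) =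
    comp (phi a (mtens b c))
      (comp (mtensh (idm (F a)) (phi b c)) (massoc (F a) (F b) (F c)));
  strong_lunit : forall a,
    comp (fmap F (mlunit a)) (comp (phi munit a) (mtensh phi0 (idm (F a)))) =
    mlunit (F a);
  strong_runit : forall a,
    comp (fmap F (mrunit a)) (comp (phi a munit) (mtensh (idm (F a)) phi0)) =
    mrunit (F a)
}.

Definition is_monoidal_equivalence (C D : monoidal_category) (F : functor C D)
    (phi : forall a b, hom (mtens (F a) (F b)) (F (mtens a b)))
    (phi0 : hom munit (F munit)) : Prop :=
  strong_monoidal phi phi0 /\ is_equivalence F.

(* MathComp's algType excludes the zero ring, which is an algebra (and a
   bialgebra) over the zero ring; and an extension of pzRingType by an lmodType
   structure cannot be declared next to algType. *)
HB.mixin Record Lmodule_isPzAlgebra (k : comPzRingType) A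
    of GRing.Lmodule k A := {
  amul : {bilin A -> A -> A};
  aone : A;
  amulA : forall a b c, amul a (amul b c) = amul (amul a b) c;
  amul1l : forall a, amul aone a = a;
  amul1r : forall a, amul a aone = a
}.
#[short(type="pzAlgType")]
HB.structure Definition PzAlgebra (k : comPzRingType) :=
  {A of GRing.Lmodule k A & Lmodule_isPzAlgebra k A}.
Notation "a ∙ b" := (amul a b) (at level 40, left associativity) : ring_scope.

HB.mixin Record isBialgebra (k : comPzRingType) B of PzAlgebra k B := {
  comul : {linear B -> (B ⊗ B)%type};
  counit : {linear B -> k^o};
  comulA : forall b,
    tassoc (tmap comul idfun (comul b)) = tmap idfun comul (comul b);
  counitl : forall b, tlunit (tmap counit idfun (comul b)) = b;
  counitr : forall b, trunit (tmap idfun counit (comul b)) = b;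
  comul1 : comul aone = aone ⊗ aone;
  comulM : forall a b, comul (a ∙ b) = tbil amul amul (comul a) (comul b);
  counit1 : counit aone = 1;
  counitM : forall a b, counit (a ∙ b) = counit a * counit b
}.
#[short(type="bialgType")]
HB.structure Definition Bialgebra (k : comPzRingType) :=
  {B of PzAlgebra k B & isBialgebra k B}.

Definition is_antipode (k : comPzRingType) (B : bialgType k)
    (S : {linear B -> B}) : Prop :=
  forall b : B,
    tlift amul (tmap S idfun (comul b)) = (counit b : k) *: aone /\
    tlift amul (tmap idfun S (comul b)) = (counit b : k) *: aone.

Definition is_Hopf_algebra (k : comPzRingType) (B : bialgType k) : Prop :=
  exists S : {linear B -> B}, is_antipode S.

(* Modules over the k-algebra B are k-modules with a k-bilinear action; for
   bimodules this makes k act in the same way on both sides. *)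
Record lmodule (k : comPzRingType) (B : pzAlgType k) := LeftModule {
  lcar :> lmodType k;
  lact : {bilin B -> lcar -> lcar};
  lact1 : forall v, lact aone v = v;
  lactM : forall a b v, lact (a ∙ b) v = lact a (lact b v)
}.
Arguments lact {k B} l : rename.

Record lmodule_hom (k : comPzRingType) (B : pzAlgType k) (V W : lmodule B) :=
  LmoduleHom {
  lfun :> {linear V -> W};
  lfun_act : forall b v, lfun (lact V b v) = lact W b (lfun v)
}.

Section LmoduleCat.
Variables (k : comPzRingType) (B : pzAlgType k).
Implicit Types U V W : lmodule B.

Lemma lhom_ext V W (f g : lmodule_hom V W) : f =1 g -> f = g.
Proof.
case: f g => [f pf] [g pg] /= /linear_ext e; subst g.
by rewrite (Prop_irrelevance pf pg).
Qed.

Lemma lhom_id_act V b v : idfun (lact V b v) = lact V b (idfun v).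
Proof. by []. Qed.
Definition lhom_id V : lmodule_hom V V := LmoduleHom (@lhom_id_act V).

Section Comp.
Variables (U V W : lmodule B) (f : lmodule_hom V W) (g : lmodule_hom U V).
Lemma lhom_comp_act b v : (f \o g) (lact U b v) = lact W b ((f \o g) v).
Proof. by rewrite /= !lfun_act. Qed.
Definition lhom_comp : lmodule_hom U W := LmoduleHom lhom_comp_act.
End Comp.

Definition lmodule_cat : category.
Proof.
apply: (@Category (lmodule B) (@lmodule_hom k B) lhom_id lhom_comp) => *.
- exact/lhom_ext.
- exact/lhom_ext.
- exact/lhom_ext.
Defined.

Lemma lhom_iso V W (f : lmodule_hom V W) (g : {linear W -> V}) :
  cancel f g -> cancel g f -> is_iso (f : @hom lmodule_cat V W).
Proof.
move=> fK gK.
have gP b w : g (lact W b w) = lact V b (g w).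
  by apply: (can_inj fK); rewrite gK lfun_act gK.
by exists (LmoduleHom gP : @hom lmodule_cat W V); split; apply: lhom_ext.
Qed.
End LmoduleCat.

Section Regular.
Variables (k : comPzRingType) (B : pzAlgType k).

Definition regular_lmodule : lmodule B :=
  @LeftModule k B B amul amul1l (fun a b v => esym (amulA a b v)).

Lemma rmul_act (c b v : B) : bilflip amul c (b ∙ v) = b ∙ bilflip amul c v.
Proof. by rewrite /bilflip amulA. Qed.
Definition rmul (c : B) : lmodule_hom regular_lmodule regular_lmodule :=
  @LmoduleHom k B regular_lmodule regular_lmodule (bilflip amul c) (rmul_act c).
End Regular.

Section LmoduleMonoidal.
Variables (k : comPzRingType) (B : bialgType k).

Section Tensor.
Variables V W : lmodule B.
(* b (v ⊗ w) = b_1 v ⊗ b_2 w *)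
Definition diag_act : {bilin B -> (V ⊗ W)%type -> (V ⊗ W)%type} :=
  bilpre (tbil (lact V) (lact W)) comul.
Lemma diag_act1 x : diag_act aone x = x.
Proof.
by rewrite /= /bilpre comul1; tens_elim x => v w; tsimp; rewrite !lact1.
Qed.
Lemma diag_actM a b x : diag_act (a ∙ b) x = diag_act a (diag_act b x).
Proof. by rewrite /= /bilpre comulM; apply: tbil_assoc => *; rewrite lactM. Qed.
Definition lmodule_tens : lmodule B := LeftModule diag_act1 diag_actM.
End Tensor.

Definition counit_act (b : B) (c : k^o) : k^o := counit b * c.
Lemma counit_act_l c : linear (counit_act ^~ c).
Proof.
move=> a x y; rewrite /counit_act linearP mulrDl; congr (_ + _).
exact/esym/mulrA.
Qed.
Lemma counit_act_r b : linear (counit_act b).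
Proof.
move=> a x y; rewrite /counit_act mulrDr; congr (_ + _).
by rewrite /GRing.scale /= mulrCA.
Qed.
HB.instance Definition _ := isBilin.Build k B k^o k^o counit_act
  counit_act_l counit_act_r.
Lemma counit_act1 c : counit_act aone c = c.
Proof. by rewrite /counit_act counit1 mul1r. Qed.
Lemma counit_actM a b c : counit_act (a ∙ b) c = counit_act a (counit_act b c).
Proof. by rewrite /counit_act counitM mulrA. Qed.
Definition lmodule_unit : lmodule B := LeftModule counit_act1 counit_actM.

Section TensorHom.
Variables (V V' W W' : lmodule B).
Variables (f : lmodule_hom V V') (g : lmodule_hom W W').
Lemma lhom_tens_act b x :
  tmap f g (lact (lmodule_tens V W) b x) =
  lact (lmodule_tens V' W') b (tmap f g x).
Proof.
rewrite /= /bilpre (tmap_tbil (g := lact V') (g' := lact W') (a := idfun)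
  (a' := idfun) (v := f) (v' := g)) ?tmap_id // => *; exact: lfun_act.
Qed.
Definition lhom_tens : lmodule_hom (lmodule_tens V W) (lmodule_tens V' W') :=
  @LmoduleHom k B (lmodule_tens V W) (lmodule_tens V' W') (tmap f g)
    lhom_tens_act.
End TensorHom.

Section Assoc.
Variables U V W : lmodule B.
Lemma lhom_assoc_act b x :
  tassoc (lact (lmodule_tens (lmodule_tens U V) W) b x) =
  lact (lmodule_tens U (lmodule_tens V W)) b (tassoc x).
Proof. by rewrite /= /bilpre tbil_prel tassoc_tbil comulA -tbil_pre. Qed.
Definition lhom_assoc :
  lmodule_hom (lmodule_tens (lmodule_tens U V) W)
    (lmodule_tens U (lmodule_tens V W)) :=
  @LmoduleHom k B (lmodule_tens (lmodule_tens U V) W)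
    (lmodule_tens U (lmodule_tens V W)) (@tassoc k U V W) lhom_assoc_act.
End Assoc.

Section Unit.
Variable V : lmodule B.
Lemma tlunit_tbil (x : B ⊗ B) (y : k^o ⊗ V) :
  tlunit (tbil counit_act (lact V) x y) =
  lact V (tlunit (tmap counit idfun x)) (tlunit y).
Proof.
tens_elim x => a a'; tens_elim y => c v; tsimp.
by rewrite bilinZl bilinZr scalerA.
Qed.
Lemma lhom_lunit_act b x :
  tlunit (lact (lmodule_tens lmodule_unit V) b x) = lact V b (tlunit x).
Proof. by rewrite /= /bilpre tlunit_tbil counitl. Qed.
Definition lhom_lunit : lmodule_hom (lmodule_tens lmodule_unit V) V :=
  @LmoduleHom k B (lmodule_tens lmodule_unit V) V (@tlunit k V) lhom_lunit_act.
Lemma trunit_tbil (x : B ⊗ B) (y : V ⊗ k^o) :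
  trunit (tbil (lact V) counit_act x y) =
  lact V (trunit (tmap idfun counit x)) (trunit y).
Proof.
tens_elim x => a a'; tens_elim y => c v; tsimp.
by rewrite bilinZl bilinZr scalerA.
Qed.
Lemma lhom_runit_act b x :
  trunit (lact (lmodule_tens V lmodule_unit) b x) = lact V b (trunit x).
Proof. by rewrite /= /bilpre trunit_tbil counitr. Qed.
Definition lhom_runit : lmodule_hom (lmodule_tens V lmodule_unit) V :=
  @LmoduleHom k B (lmodule_tens V lmodule_unit) V (@trunit k V) lhom_runit_act.

Lemma tlunitK : cancel (@tlunit k V) (tensl (1 : k^o)).
Proof.
move=> x; rewrite /tensl; tens_elim x => c v; tsimp.
by rewrite bilinZr -bilinZl /GRing.scale /= mulr1.
Qed.
Lemma tlunitVK : cancel (tensl (1 : k^o)) (@tlunit k V).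
Proof. by move=> v; rewrite /tensl; tsimp; rewrite scale1r. Qed.
Lemma trunitK : cancel (@trunit k V) (tensr (1 : k^o)).
Proof.
move=> x; rewrite /tensr; tens_elim x => v c; tsimp.
by rewrite bilinZl -bilinZr /GRing.scale /= mulr1.
Qed.
Lemma trunitVK : cancel (tensr (1 : k^o)) (@trunit k V).
Proof. by move=> v; rewrite /tensr; tsimp; rewrite scale1r. Qed.
End Unit.


Lemma lhom_tens_id V W :
  lhom_tens (lhom_id V) (lhom_id W) = lhom_id (lmodule_tens V W).
Proof. by apply: lhom_ext => x /=; rewrite tmap_id. Qed.

Lemma lhom_tens_comp V V' V'' W W' W''
  (f : lmodule_hom V' V'') (f' : lmodule_hom V V')
  (g : lmodule_hom W' W'') (g' : lmodule_hom W W') :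
  lhom_tens (lhom_comp f f') (lhom_comp g g') =
  lhom_comp (lhom_tens f g) (lhom_tens f' g').
Proof. by apply: lhom_ext => x /=; rewrite tmap_comp. Qed.

Lemma lhom_assoc_nat U U' V V' W W' (f : lmodule_hom U U')
  (g : lmodule_hom V V') (h : lmodule_hom W W') :
  lhom_comp (lhom_assoc U' V' W') (lhom_tens (lhom_tens f g) h) =
  lhom_comp (lhom_tens f (lhom_tens g h)) (lhom_assoc U V W).
Proof. by apply: lhom_ext => x /=; rewrite tassoc_nat. Qed.

Lemma lhom_lunit_nat V W (f : lmodule_hom V W) :
  lhom_comp (lhom_lunit W) (lhom_tens (lhom_id lmodule_unit) f) =
  lhom_comp f (lhom_lunit V).
Proof. by apply/lhom_ext/tens_ext2 => c v /=; tsimp; rewrite linearZ. Qed.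

Lemma lhom_runit_nat V W (f : lmodule_hom V W) :
  lhom_comp (lhom_runit W) (lhom_tens f (lhom_id lmodule_unit)) =
  lhom_comp f (lhom_runit V).
Proof. by apply/lhom_ext/tens_ext2 => v c /=; tsimp; rewrite linearZ. Qed.

Lemma lhom_pentagon U V W X :
  lhom_comp (lhom_assoc U V (lmodule_tens W X))
    (lhom_assoc (lmodule_tens U V) W X) =
  lhom_comp (lhom_tens (lhom_id U) (lhom_assoc V W X))
    (lhom_comp (lhom_assoc U (lmodule_tens V W) X)
      (lhom_tens (lhom_assoc U V W) (lhom_id X))).
Proof. by apply/lhom_ext/tens_ext4 => u v w x /=; tsimp. Qed.

Lemma lhom_triangle V W :
  lhom_comp (lhom_tens (lhom_id V) (lhom_lunit W)) (lhom_assoc V lmodule_unit W) =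
  lhom_tens (lhom_runit V) (lhom_id W).
Proof.
by apply/lhom_ext/tens_ext3 => v c w /=; tsimp; rewrite bilinZl bilinZr.
Qed.

Definition lmodule_moncat : monoidal_category :=
  @MonoidalCategory (lmodule_cat B) lmodule_unit lmodule_tens
    lhom_tens lhom_assoc lhom_lunit lhom_runit
    lhom_tens_id lhom_tens_comp
    (fun U V W => @lhom_iso _ _ _ _ (lhom_assoc U V W) (@tassocV k U V W)
      (@tassocK _ _ _ _) (@tassocVK _ _ _ _))
    (fun V => @lhom_iso _ _ _ _ (lhom_lunit V) (tensl (1 : k^o))
      (@tlunitK V) (@tlunitVK V))
    (fun V => @lhom_iso _ _ _ _ (lhom_runit V) (tensr (1 : k^o))
      (@trunitK V) (@trunitVK V))
    lhom_assoc_nat lhom_lunit_nat lhom_runit_nat lhom_pentagon lhom_triangle.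
End LmoduleMonoidal.

Record hopfmod (k : comPzRingType) (B : bialgType k) := HopfModule {
  hcar :> lmodType k;
  hl : {bilin B -> hcar -> hcar};
  hr : {bilin hcar -> B -> hcar};
  delta : {linear hcar -> (hcar ⊗ B)%type};
  hl1 : forall m, hl aone m = m;
  hlM : forall a b m, hl (a ∙ b) m = hl a (hl b m);
  hr1 : forall m, hr m aone = m;
  hrM : forall m a b, hr m (a ∙ b) = hr (hr m a) b;
  hlr : forall a m b, hr (hl a m) b = hl a (hr m b);
  deltaA : forall m,
    tassoc (tmap delta idfun (delta m)) = tmap idfun comul (delta m);
  delta_counit : forall m, trunit (tmap idfun counit (delta m)) = m;
  (* a_1 m_0 b_1 ⊗ a_2 m_1 b_2 *)
  delta_act : forall a m b, delta (hr (hl a m) b) =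
    tbil hr amul (tbil hl amul (comul a) (delta m)) (comul b)
}.
Arguments hl {k B} h : rename.
Arguments hr {k B} h : rename.
Arguments delta {k B} h : rename.

Record hopfmod_hom (k : comPzRingType) (B : bialgType k) (M N : hopfmod B) :=
  HopfmodHom {
  hfun :> {linear M -> N};
  hfun_l : forall b m, hfun (hl M b m) = hl N b (hfun m);
  hfun_r : forall m b, hfun (hr M m b) = hr N (hfun m) b;
  hfun_delta : forall m, delta N (hfun m) = tmap hfun idfun (delta M m)
}.

Section HopfmodCat.
Variables (k : comPzRingType) (B : bialgType k).
Implicit Types M N P : hopfmod B.

Lemma delta_l M a m : delta M (hl M a m) = tbil (hl M) amul (comul a) (delta M m).
Proof.
rewrite -[hl M a m in LHS]hr1 delta_act comul1.
move: (tbil (hl M) amul _ _) => x; tens_elim x => n b; tsimp.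
by rewrite hr1 amul1r.
Qed.
Lemma delta_r M m b : delta M (hr M m b) = tbil (hr M) amul (delta M m) (comul b).
Proof.
rewrite -[m in LHS]hl1 delta_act comul1; congr tbil.
move: (delta M m) => x; tens_elim x => n c; tsimp.
by rewrite hl1 amul1l.
Qed.

Lemma hhom_ext M N (f g : hopfmod_hom M N) : f =1 g -> f = g.
Proof.
case: f g => [f p q r] [g p' q' r'] /= /linear_ext e; subst g.
by rewrite (Prop_irrelevance p p') (Prop_irrelevance q q')
  (Prop_irrelevance r r').
Qed.

Section Id.
Variable M : hopfmod B.
Lemma hhom_id_delta m : delta M (idfun m) = tmap idfun idfun (delta M m).
Proof. by rewrite tmap_id. Qed.
Definition hhom_id : hopfmod_hom M M :=
  @HopfmodHom k B M M idfun (fun _ _ => erefl) (fun _ _ => erefl) hhom_id_delta.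
End Id.

Section Comp.
Variables (M N P : hopfmod B) (f : hopfmod_hom N P) (g : hopfmod_hom M N).
Lemma hhom_comp_l b m : (f \o g) (hl M b m) = hl P b ((f \o g) m).
Proof. by rewrite /= !hfun_l. Qed.
Lemma hhom_comp_r m b : (f \o g) (hr M m b) = hr P ((f \o g) m) b.
Proof. by rewrite /= !hfun_r. Qed.
Lemma hhom_comp_delta m :
  delta P ((f \o g) m) = tmap (f \o g) idfun (delta M m).
Proof. by rewrite /= !hfun_delta tmap_comp; apply: eq_tmap. Qed.
Definition hhom_comp : hopfmod_hom M P :=
  HopfmodHom hhom_comp_l hhom_comp_r hhom_comp_delta.
End Comp.

Definition hopfmod_cat : category.
Proof.
apply: (@Category (hopfmod B) (@hopfmod_hom k B) hhom_id hhom_comp) => *.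
- exact/hhom_ext.
- exact/hhom_ext.
- exact/hhom_ext.
Defined.

Lemma hhom_iso M N (f : hopfmod_hom M N) (g : {linear N -> M}) :
  cancel f g -> cancel g f -> is_iso (f : @hom hopfmod_cat M N).
Proof.
move=> fK gK.
have gl b n : g (hl N b n) = hl M b (g n).
  by apply: (can_inj fK); rewrite gK hfun_l gK.
have gr n b : g (hr N n b) = hr M (g n) b.
  by apply: (can_inj fK); rewrite gK hfun_r gK.
have gd n : delta M (g n) = tmap g idfun (delta N n).
  rewrite -{2}[n]gK hfun_delta tmap_comp -[LHS]tmap_id; apply: eq_tmap => //.
  by move=> m /=; rewrite fK.
by exists (HopfmodHom gl gr gd : @hom hopfmod_cat N M); split; apply: hhom_ext.
Qed.
End HopfmodCat.

Section BTensor.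
Variables (k : comPzRingType) (B M N : lmodType k).
Variables (r : {bilin M -> B -> M}) (l : {bilin B -> N -> N}).

Definition btensor_rel (t : M ⊗ N) : Prop :=
  exists m b n, t = r m b ⊗ n - m ⊗ l b n.
Definition btensor : Type := quot btensor_rel.
HB.instance Definition _ := GRing.Lmodule.on btensor.

Definition btens (m : M) (n : N) : btensor := qpi btensor_rel (m ⊗ n).
Lemma btens_l n : linear (btens ^~ n).
Proof. by move=> c x y; rewrite /btens bilinDl bilinZl linearP. Qed.
Lemma btens_r m : linear (btens m).
Proof. by move=> c x y; rewrite /btens bilinDr bilinZr linearP. Qed.
HB.instance Definition _ := isBilin.Build k M N btensor btens btens_l btens_r.

Lemma btens_bal m b n : btens (r m b) n = btens m (l b n).
Proof.
by apply/eqP; rewrite -subr_eq0 -linearB; apply/eqP/qpi_eq0; exists m, b, n.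
Qed.

Lemma btens_ind (P : btensor -> Prop) :
  P 0 -> (forall m n, P (btens m n)) -> (forall x y, P x -> P y -> P (x + y)) ->
  forall x, P x.
Proof.
move=> P0 Pt PD; elim/quot_ind => x; elim/tens_ind: x => [|m n|x y].
- by rewrite linear0.
- exact: Pt.
- by rewrite linearD; apply: PD.
Qed.

Section Lift.
Variables (U : lmodType k) (f : {bilin M -> N -> U}).
Hypothesis f_bal : forall m b n, f (r m b) n = f m (l b n).
Lemma blift_subproof t : btensor_rel t -> tlift f t = 0.
Proof. by move=> [m [b [n ->]]]; rewrite linearB /= !tliftE f_bal subrr. Qed.
Definition blift : btensor -> U := qlift blift_subproof.
HB.instance Definition _ := GRing.Linear.on blift.
Lemma bliftE m n : blift (btens m n) = f m n.
Proof. by rewrite /blift qliftE /= tliftE. Qed.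
End Lift.
End BTensor.

Ltac btens_elim x :=
  elim/btens_ind: x;
  [by rewrite !lin0E | | by move=> ? ?; rewrite !linDE /= => -> ->].

Section BExt.
Variables (k : comPzRingType) (B : lmodType k).

Lemma btens_ext2 (M N X : lmodType k)
  (r : {bilin M -> B -> M}) (l : {bilin B -> N -> N})
  (f g : {linear btensor r l -> X}) :
  (forall m n, f (btens r l m n) = g (btens r l m n)) -> f =1 g.
Proof. by move=> e x; btens_elim x. Qed.
End BExt.

Section HopfmodMonoidal.
Variables (k : comPzRingType) (B : bialgType k).

Definition hopfmod_unit : hopfmod B.
Proof.
refine (@HopfModule k B B amul amul comul amul1l (fun a b m => esym (amulA a b m))
  amul1r amulA (fun a m b => esym (amulA a m b)) (@comulA k B) (@counitr k B) _).
by move=> a m b; rewrite !comulM.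
Defined.

Section Tensor.
Variables M N : hopfmod B.
Local Notation MN := (btensor (hr M) (hl N)).
Local Notation bt := (btens (hr M) (hl N)).

Section Acts.
Variable a : B.
Definition btl_pure (m : M) (n : N) : MN := bt (hl M a m) n.
Lemma btl_pure_l n : linear (btl_pure ^~ n).
Proof. by move=> c x y; rewrite /btl_pure bilinDr bilinZr bilinDl bilinZl. Qed.
Lemma btl_pure_r m : linear (btl_pure m).
Proof. by move=> c x y; rewrite /btl_pure bilinDr bilinZr. Qed.
HB.instance Definition _ := isBilin.Build k M N MN btl_pure btl_pure_l btl_pure_r.
Lemma btl_bal m b n : btl_pure (hr M m b) n = btl_pure m (hl N b n).
Proof. by rewrite /btl_pure -hlr btens_bal. Qed.

Definition btr_pure (m : M) (n : N) : MN := bt m (hr N n a).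
Lemma btr_pure_l n : linear (btr_pure ^~ n).
Proof. by move=> c x y; rewrite /btr_pure bilinDl bilinZl. Qed.
Lemma btr_pure_r m : linear (btr_pure m).
Proof. by move=> c x y; rewrite /btr_pure bilinDl bilinZl bilinDr bilinZr. Qed.
HB.instance Definition _ := isBilin.Build k M N MN btr_pure btr_pure_l btr_pure_r.
Lemma btr_bal m b n : btr_pure (hr M m b) n = btr_pure m (hl N b n).
Proof. by rewrite /btr_pure btens_bal hlr. Qed.
End Acts.

Definition bt_hl (a : B) (x : MN) : MN := blift (btl_bal a) x.
Lemma bt_hlE a m n : bt_hl a (bt m n) = bt (hl M a m) n.
Proof. by rewrite /bt_hl bliftE. Qed.
Lemma bt_hl_l x : linear (bt_hl ^~ x).
Proof.
move=> c a b; elim/btens_ind: x => [|m n|x y IH IH'].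
- by rewrite /bt_hl !lin0E.
- by rewrite !bt_hlE bilinDl bilinZl bilinDl bilinZl.
- move: IH IH'; rewrite /bt_hl !linearD /= => -> ->; exact: addrACA.
Qed.
Lemma bt_hl_r a : linear (bt_hl a).
Proof. by move=> c x y; rewrite /bt_hl linearP. Qed.
HB.instance Definition _ := isBilin.Build k B MN MN bt_hl bt_hl_l bt_hl_r.

Definition bt_hr (x : MN) (a : B) : MN := blift (btr_bal a) x.
Lemma bt_hrE a m n : bt_hr (bt m n) a = bt m (hr N n a).
Proof. by rewrite /bt_hr bliftE. Qed.
Lemma bt_hr_r x : linear (bt_hr x).
Proof.
move=> c a b; elim/btens_ind: x => [|m n|x y IH IH'].
- by rewrite /bt_hr !lin0E.
- by rewrite !bt_hrE bilinDr bilinZr bilinDr bilinZr.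
- move: IH IH'; rewrite /bt_hr !linearD /= => -> ->; exact: addrACA.
Qed.
Lemma bt_hr_l a : linear (bt_hr ^~ a).
Proof. by move=> c x y; rewrite /bt_hr linearP. Qed.
HB.instance Definition _ := isBilin.Build k MN B MN bt_hr bt_hr_l bt_hr_r.

(* m ⊗_B n |-> (m_0 ⊗_B n_0) ⊗ m_1 n_1 *)
Definition btdelta_pure (m : M) (n : N) : MN ⊗ B :=
  tbil bt amul (delta M m) (delta N n).
Lemma btdelta_pure_l n : linear (btdelta_pure ^~ n).
Proof. by move=> c x y; rewrite /btdelta_pure linearP bilinDl bilinZl. Qed.
Lemma btdelta_pure_r m : linear (btdelta_pure m).
Proof. by move=> c x y; rewrite /btdelta_pure linearP bilinDr bilinZr. Qed.
HB.instance Definition _ :=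
  isBilin.Build k M N (MN ⊗ B)%type btdelta_pure btdelta_pure_l btdelta_pure_r.
Lemma btdelta_bal m b n : btdelta_pure (hr M m b) n = btdelta_pure m (hl N b n).
Proof.
rewrite /btdelta_pure delta_r delta_l; apply: tbil_assoc => *.
- exact: btens_bal.
- by rewrite amulA.
Qed.
Definition bt_delta : MN -> MN ⊗ B := blift btdelta_bal.
HB.instance Definition _ := GRing.Linear.on bt_delta.
Lemma bt_deltaE m n : bt_delta (bt m n) = tbil bt amul (delta M m) (delta N n).
Proof. by rewrite /bt_delta bliftE. Qed.

Lemma bt_deltaA x :
  tassoc (tmap bt_delta idfun (bt_delta x)) = tmap idfun comul (bt_delta x).
Proof.
btens_elim x => m n; rewrite bt_deltaE.
rewrite (tmap_tbil (g := tbil bt amul) (g' := amul) (a := delta M) (a' := idfun)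
  (v := delta N) (v' := idfun)) //; last exact: bt_deltaE.
rewrite tassoc_tbil !deltaA.
by rewrite (tmap_tbil (g := bt) (g' := tbil amul amul) (a := idfun) (a' := comul)
  (v := idfun) (v' := comul)) // => *; rewrite comulM.
Qed.

Lemma trunit_bt (x : M ⊗ B) (y : N ⊗ B) :
  trunit (tmap idfun counit (tbil bt amul x y)) =
  bt (trunit (tmap idfun counit x)) (trunit (tmap idfun counit y)).
Proof.
tens_elim x => m a; tens_elim y => n b; tsimp.
by rewrite counitM bilinZl bilinZr scalerA.
Qed.
Lemma bt_delta_counit x : trunit (tmap idfun counit (bt_delta x)) = x.
Proof.
by btens_elim x => m n; rewrite bt_deltaE trunit_bt !delta_counit.
Qed.

Lemma bt_delta_act a x b : bt_delta (bt_hr (bt_hl a x) b) =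
  tbil bt_hr amul (tbil bt_hl amul (comul a) (bt_delta x)) (comul b).
Proof.
btens_elim x => m n; rewrite bt_hlE bt_hrE !bt_deltaE delta_l delta_r.
move: (comul a) (delta M m) (delta N n) (comul b) => s t u v.
tens_elim s => a1 a2; tens_elim t => m0 m1; tens_elim u => n0 n1.
by tens_elim v => b1 b2; tsimp; rewrite bt_hlE bt_hrE !amulA.
Qed.

Definition hopfmod_tens : hopfmod B.
Proof.
refine (@HopfModule k B MN bt_hl bt_hr bt_delta _ _ _ _ _
  bt_deltaA bt_delta_counit bt_delta_act).
- by move=> x; btens_elim x => m n; rewrite /= bt_hlE hl1.
- by move=> a b x; btens_elim x => m n; rewrite /= !bt_hlE hlM.
- by move=> x; btens_elim x => m n; rewrite /= bt_hrE hr1.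
- by move=> x a b; btens_elim x => m n; rewrite /= !bt_hrE hrM.
- by move=> a x b; btens_elim x => m n; rewrite /= !(bt_hrE,bt_hlE).
Defined.
End Tensor.
Local Notation "m ⊗' n" :=
  (btens (hr _) (hl _) m n : hopfmod_tens _ _) (at level 40).

Section TensorHom.
Variables (M M' N N' : hopfmod B) (f : hopfmod_hom M M') (g : hopfmod_hom N N').
Definition btmap_pure (m : M) (n : N) : hopfmod_tens M' N' := f m ⊗' g n.
Lemma btmap_pure_l n : linear (btmap_pure ^~ n).
Proof. by move=> c x y; rewrite /btmap_pure linearP bilinDl bilinZl. Qed.
Lemma btmap_pure_r m : linear (btmap_pure m).
Proof. by move=> c x y; rewrite /btmap_pure linearP bilinDr bilinZr. Qed.
HB.instance Definition _ :=
  isBilin.Build k M N (hopfmod_tens M' N') btmap_pure btmap_pure_l btmap_pure_r.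
Lemma btmap_bal m b n : btmap_pure (hr M m b) n = btmap_pure m (hl N b n).
Proof. by rewrite /btmap_pure hfun_r hfun_l btens_bal. Qed.
Definition btmap : hopfmod_tens M N -> hopfmod_tens M' N' := blift btmap_bal.
HB.instance Definition _ := GRing.Linear.on btmap.
Lemma btmapE m n : btmap (m ⊗' n) = f m ⊗' g n.
Proof. exact: bliftE. Qed.

Definition hhom_tens : hopfmod_hom (hopfmod_tens M N) (hopfmod_tens M' N').
Proof.
refine (@HopfmodHom k B (hopfmod_tens M N) (hopfmod_tens M' N') btmap _ _ _).
- move=> b x; btens_elim x => m n.
  by rewrite /= bt_hlE !btmapE bt_hlE hfun_l.
- move=> x b; btens_elim x => m n.
  by rewrite /= bt_hrE !btmapE bt_hrE hfun_r.
- move=> x; btens_elim x => m n.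
  rewrite /= btmapE !bt_deltaE !hfun_delta; apply/esym/tmap_tbil => // *.
  exact: btmapE.
Defined.
End TensorHom.

Section Assoc.
Variables M N P : hopfmod B.
Section Pure.
Variable p : P.
Definition btassoc_pure (m : M) (n : N) : hopfmod_tens M (hopfmod_tens N P) :=
  m ⊗' (n ⊗' p).
Lemma btassoc_pure_l n : linear (btassoc_pure ^~ n).
Proof. by move=> c x y; rewrite /btassoc_pure bilinDl bilinZl. Qed.
Lemma btassoc_pure_r m : linear (btassoc_pure m).
Proof. by move=> c x y; rewrite /btassoc_pure bilinDl bilinZl bilinDr bilinZr. Qed.
HB.instance Definition _ := isBilin.Build k M N (hopfmod_tens M (hopfmod_tens N P))
  btassoc_pure btassoc_pure_l btassoc_pure_r.
Lemma btassoc_pure_bal m b n :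
  btassoc_pure (hr M m b) n = btassoc_pure m (hl N b n).
Proof. by rewrite /btassoc_pure btens_bal /= bt_hlE. Qed.
End Pure.
Definition btassoc_left (x : hopfmod_tens M N) (p : P) :
    hopfmod_tens M (hopfmod_tens N P) :=
  blift (btassoc_pure_bal p) x.
Lemma btassoc_leftE m n p : btassoc_left (m ⊗' n) p = m ⊗' (n ⊗' p).
Proof. exact: bliftE. Qed.
Lemma btassoc_left_l p : linear (btassoc_left ^~ p).
Proof. by move=> c x y; rewrite /btassoc_left linearP. Qed.
Lemma btassoc_left_r x : linear (btassoc_left x).
Proof.
move=> c a b; elim/btens_ind: x => [|m n|x y IH IH'].
- by rewrite /btassoc_left !lin0E.
- by rewrite !btassoc_leftE !(bilinDr, bilinZr).
- move: IH IH'; rewrite /btassoc_left !linearD /= => -> ->; exact: addrACA.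
Qed.
HB.instance Definition _ := isBilin.Build k (hopfmod_tens M N) P
  (hopfmod_tens M (hopfmod_tens N P)) btassoc_left btassoc_left_l btassoc_left_r.
Lemma btassoc_bal x b p :
  btassoc_left (hr (hopfmod_tens M N) x b) p = btassoc_left x (hl P b p).
Proof.
btens_elim x => m n.
by rewrite /= bt_hrE !btassoc_leftE btens_bal.
Qed.
Definition btassoc : hopfmod_tens (hopfmod_tens M N) P ->
    hopfmod_tens M (hopfmod_tens N P) := blift btassoc_bal.
HB.instance Definition _ := GRing.Linear.on btassoc.
Lemma btassocE m n p : btassoc ((m ⊗' n) ⊗' p) = m ⊗' (n ⊗' p).
Proof. by rewrite /btassoc bliftE /= btassoc_leftE. Qed.

Section PureV.
Variable m : M.
Definition btassocV_pure (n : N) (p : P) : hopfmod_tens (hopfmod_tens M N) P :=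
  (m ⊗' n) ⊗' p.
Lemma btassocV_pure_l p : linear (btassocV_pure ^~ p).
Proof. by move=> c x y; rewrite /btassocV_pure bilinDr bilinZr bilinDl bilinZl. Qed.
Lemma btassocV_pure_r n : linear (btassocV_pure n).
Proof. by move=> c x y; rewrite /btassocV_pure bilinDr bilinZr. Qed.
HB.instance Definition _ := isBilin.Build k N P (hopfmod_tens (hopfmod_tens M N) P)
  btassocV_pure btassocV_pure_l btassocV_pure_r.
Lemma btassocV_pure_bal n b p :
  btassocV_pure (hr N n b) p = btassocV_pure n (hl P b p).
Proof. by rewrite /btassocV_pure -btens_bal /= bt_hrE. Qed.
End PureV.
Definition btassocV_right (m : M) (x : hopfmod_tens N P) :
    hopfmod_tens (hopfmod_tens M N) P :=
  blift (btassocV_pure_bal m) x.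
Lemma btassocV_rightE m n p : btassocV_right m (n ⊗' p) = (m ⊗' n) ⊗' p.
Proof. exact: bliftE. Qed.
Lemma btassocV_right_r m : linear (btassocV_right m).
Proof. by move=> c x y; rewrite /btassocV_right linearP. Qed.
Lemma btassocV_right_l x : linear (btassocV_right ^~ x).
Proof.
move=> c a b; elim/btens_ind: x => [|m n|x y IH IH'].
- by rewrite /btassocV_right !lin0E.
- by rewrite !btassocV_rightE !(bilinDl, bilinZl).
- move: IH IH'; rewrite /btassocV_right !linearD /= => -> ->; exact: addrACA.
Qed.
HB.instance Definition _ := isBilin.Build k M (hopfmod_tens N P)
  (hopfmod_tens (hopfmod_tens M N) P) btassocV_right btassocV_right_l btassocV_right_r.
Lemma btassocV_bal m b x :
  btassocV_right (hr M m b) x = btassocV_right m (hl (hopfmod_tens N P) b x).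
Proof.
btens_elim x => n p.
by rewrite /= bt_hlE !btassocV_rightE btens_bal.
Qed.
Definition btassocV : hopfmod_tens M (hopfmod_tens N P) ->
    hopfmod_tens (hopfmod_tens M N) P := blift btassocV_bal.
HB.instance Definition _ := GRing.Linear.on btassocV.
Lemma btassocVE m n p : btassocV (m ⊗' (n ⊗' p)) = (m ⊗' n) ⊗' p.
Proof. by rewrite /btassocV bliftE /= btassocV_rightE. Qed.

Lemma btassocK : cancel btassoc btassocV.
Proof.
move=> x; btens_elim x => x p; btens_elim x => m n.
by rewrite btassocE btassocVE.
Qed.
Lemma btassocVK : cancel btassocV btassoc.
Proof.
move=> x; btens_elim x => m x; btens_elim x => n p.
by rewrite btassocVE btassocE.
Qed.

Definition hhom_assoc : hopfmod_hom (hopfmod_tens (hopfmod_tens M N) P)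
  (hopfmod_tens M (hopfmod_tens N P)).
Proof.
refine (@HopfmodHom k B (hopfmod_tens (hopfmod_tens M N) P)
  (hopfmod_tens M (hopfmod_tens N P)) btassoc _ _ _).
- move=> b x; btens_elim x => x p; btens_elim x => m n.
  by rewrite /= bt_hlE /= bt_hlE !btassocE bt_hlE.
- move=> x b; btens_elim x => x p; btens_elim x => m n.
  by rewrite /= bt_hrE !btassocE bt_hrE /= bt_hrE.
- move=> x; btens_elim x => x p; btens_elim x => m n.
  rewrite /= btassocE !bt_deltaE /= !bt_deltaE.
  move: (delta M m) (delta N n) (delta P p) => {m n p} x y z.
  tens_elim x => m a; tens_elim y => n b; tens_elim z => p c.
  by tsimp; rewrite btassocE amulA.
Defined.
End Assoc.

Section Unit.
Variable M : hopfmod B.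
Lemma btlunit_bal a b (m : M) : hl M (a ∙ b) m = hl M a (hl M b m).
Proof. exact: hlM. Qed.
Definition btlunit : hopfmod_tens hopfmod_unit M -> M := blift btlunit_bal.
HB.instance Definition _ := GRing.Linear.on btlunit.
Lemma btlunitE (b : hopfmod_unit) m : btlunit (b ⊗' m) = hl M b m.
Proof. exact: bliftE. Qed.
Definition btlunitV (m : M) : hopfmod_tens hopfmod_unit M :=
  (aone : hopfmod_unit) ⊗' m.
Lemma btlunitV_linear : linear btlunitV.
Proof. by move=> c x y; rewrite /btlunitV bilinDr bilinZr. Qed.
HB.instance Definition _ := GRing.isLinear.Build k M
  (hopfmod_tens hopfmod_unit M) _ btlunitV btlunitV_linear.
Lemma btlunitK : cancel btlunit btlunitV.
Proof.
move=> x; btens_elim x => b m.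
by rewrite btlunitE /btlunitV -btens_bal /= amul1l.
Qed.
Lemma btlunitVK : cancel btlunitV btlunit.
Proof. by move=> m; rewrite btlunitE hl1. Qed.
Definition hhom_lunit : hopfmod_hom (hopfmod_tens hopfmod_unit M) M.
Proof.
refine (@HopfmodHom k B (hopfmod_tens hopfmod_unit M) M btlunit _ _ _).
- move=> b x; btens_elim x => c m.
  by rewrite /= bt_hlE !btlunitE /= hlM.
- move=> x b; btens_elim x => c m.
  by rewrite /= bt_hrE !btlunitE hlr.
- move=> x; btens_elim x => c m.
  rewrite /= btlunitE bt_deltaE delta_l /=.
  move: (comul c) (delta M m) => {c m} x y.
  tens_elim x => a b; tens_elim y => m c.
  by tsimp; rewrite btlunitE.
Defined.

Lemma btrunit_bal (m : M) b a : hr M (hr M m b) a = hr M m (b ∙ a).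
Proof. by rewrite hrM. Qed.
Definition btrunit : hopfmod_tens M hopfmod_unit -> M := blift btrunit_bal.
HB.instance Definition _ := GRing.Linear.on btrunit.
Lemma btrunitE m (b : hopfmod_unit) : btrunit (m ⊗' b) = hr M m b.
Proof. exact: bliftE. Qed.
Definition btrunitV (m : M) : hopfmod_tens M hopfmod_unit :=
  m ⊗' (aone : hopfmod_unit).
Lemma btrunitV_linear : linear btrunitV.
Proof. by move=> c x y; rewrite /btrunitV bilinDl bilinZl. Qed.
HB.instance Definition _ := GRing.isLinear.Build k M
  (hopfmod_tens M hopfmod_unit) _ btrunitV btrunitV_linear.
Lemma btrunitK : cancel btrunit btrunitV.
Proof.
move=> x; btens_elim x => m b.
by rewrite btrunitE /btrunitV btens_bal /= amul1r.
Qed.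
Lemma btrunitVK : cancel btrunitV btrunit.
Proof. by move=> m; rewrite btrunitE hr1. Qed.
Definition hhom_runit : hopfmod_hom (hopfmod_tens M hopfmod_unit) M.
Proof.
refine (@HopfmodHom k B (hopfmod_tens M hopfmod_unit) M btrunit _ _ _).
- move=> b x; btens_elim x => m c.
  by rewrite /= bt_hlE !btrunitE hlr.
- move=> x b; btens_elim x => m c.
  by rewrite /= bt_hrE !btrunitE /= hrM.
- move=> x; btens_elim x => m c.
  rewrite /= btrunitE bt_deltaE delta_r /=.
  move: (delta M m) (comul c) => {c m} x y.
  tens_elim x => m a; tens_elim y => b c.
  by tsimp; rewrite btrunitE.
Defined.
End Unit.


Lemma hopfmod_ext2 (M N : hopfmod B) (X : lmodType k)
  (f g : {linear hopfmod_tens M N -> X}) :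
  (forall m n, f (m ⊗' n) = g (m ⊗' n)) -> f =1 g.
Proof. exact: btens_ext2. Qed.

Lemma hopfmod_ext3 (M N P : hopfmod B) (X : lmodType k)
  (f g : {linear hopfmod_tens (hopfmod_tens M N) P -> X}) :
  (forall m n p, f ((m ⊗' n) ⊗' p) = g ((m ⊗' n) ⊗' p)) -> f =1 g.
Proof.
move=> e; apply: hopfmod_ext2 => x p.
pose h := bilflip (btens (hr (hopfmod_tens M N)) (hl P)) p.
exact: (@hopfmod_ext2 M N X (f \o h) (g \o h) (fun m n => e m n p)).
Qed.

Lemma hopfmod_ext4 (M N P Q : hopfmod B) (X : lmodType k)
  (f g : {linear hopfmod_tens (hopfmod_tens (hopfmod_tens M N) P) Q -> X}) :
  (forall m n p q,
     f (((m ⊗' n) ⊗' p) ⊗' q) = g (((m ⊗' n) ⊗' p) ⊗' q)) -> f =1 g.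
Proof.
move=> e; apply: hopfmod_ext2 => x q.
pose h := bilflip (btens (hr (hopfmod_tens (hopfmod_tens M N) P)) (hl Q)) q.
exact: (@hopfmod_ext3 M N P X (f \o h) (g \o h) (fun m n p => e m n p q)).
Qed.

Lemma hhom_tens_id M N :
  hhom_tens (hhom_id M) (hhom_id N) = hhom_id (hopfmod_tens M N).
Proof. by apply/hhom_ext/hopfmod_ext2 => m n /=; rewrite btmapE. Qed.

Lemma hhom_tens_comp M M' M'' N N' N''
  (f : hopfmod_hom M' M'') (f' : hopfmod_hom M M')
  (g : hopfmod_hom N' N'') (g' : hopfmod_hom N N') :
  hhom_tens (hhom_comp f f') (hhom_comp g g') =
  hhom_comp (hhom_tens f g) (hhom_tens f' g').
Proof. by apply/hhom_ext/hopfmod_ext2 => m n /=; rewrite !btmapE. Qed.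

Lemma hhom_assoc_nat M M' N N' P P' (f : hopfmod_hom M M')
  (g : hopfmod_hom N N') (h : hopfmod_hom P P') :
  hhom_comp (hhom_assoc M' N' P') (hhom_tens (hhom_tens f g) h) =
  hhom_comp (hhom_tens f (hhom_tens g h)) (hhom_assoc M N P).
Proof.
apply/hhom_ext/hopfmod_ext3 => m n p /=.
by rewrite !(btmapE, btassocE) /= !(btmapE, btassocE).
Qed.

Lemma hhom_lunit_nat M N (f : hopfmod_hom M N) :
  hhom_comp (hhom_lunit N) (hhom_tens (hhom_id hopfmod_unit) f) =
  hhom_comp f (hhom_lunit M).
Proof.
by apply/hhom_ext/hopfmod_ext2 => b m /=; rewrite btmapE !btlunitE /= hfun_l.
Qed.

Lemma hhom_runit_nat M N (f : hopfmod_hom M N) :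
  hhom_comp (hhom_runit N) (hhom_tens f (hhom_id hopfmod_unit)) =
  hhom_comp f (hhom_runit M).
Proof.
by apply/hhom_ext/hopfmod_ext2 => m b /=; rewrite btmapE !btrunitE /= hfun_r.
Qed.

Lemma hhom_pentagon M N P Q :
  hhom_comp (hhom_assoc M N (hopfmod_tens P Q))
    (hhom_assoc (hopfmod_tens M N) P Q) =
  hhom_comp (hhom_tens (hhom_id M) (hhom_assoc N P Q))
    (hhom_comp (hhom_assoc M (hopfmod_tens N P) Q)
      (hhom_tens (hhom_assoc M N P) (hhom_id Q))).
Proof.
apply/hhom_ext/hopfmod_ext4 => m n p q /=.
by rewrite !(btmapE, btassocE) /= !(btmapE, btassocE) /= btassocE.
Qed.

Lemma hhom_triangle M N :
  hhom_comp (hhom_tens (hhom_id M) (hhom_lunit N)) (hhom_assoc M hopfmod_unit N) =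
  hhom_tens (hhom_runit M) (hhom_id N).
Proof.
apply/hhom_ext/hopfmod_ext3 => m b n /=.
by rewrite !(btmapE, btassocE) /= !(btlunitE,btrunitE) btens_bal.
Qed.

Definition hopfmod_moncat : monoidal_category :=
  @MonoidalCategory (hopfmod_cat B) hopfmod_unit hopfmod_tens
    hhom_tens hhom_assoc hhom_lunit hhom_runit
    hhom_tens_id hhom_tens_comp
    (fun M N P => @hhom_iso _ _ _ _ (hhom_assoc M N P) (@btassocV M N P)
      (@btassocK M N P) (@btassocVK M N P))
    (fun M => @hhom_iso _ _ _ _ (hhom_lunit M) (@btlunitV M)
      (@btlunitK M) (@btlunitVK M))
    (fun M => @hhom_iso _ _ _ _ (hhom_runit M) (@btrunitV M)
      (@btrunitK M) (@btrunitVK M))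
    hhom_assoc_nat hhom_lunit_nat hhom_runit_nat hhom_pentagon hhom_triangle.
End HopfmodMonoidal.

Section FreeHopfmod.
Variables (k : comPzRingType) (B : bialgType k).

Section Obj.
Variable V : lmodule B.

(* a (v ⊗ b) c = a_1 v ⊗ a_2 b c and v ⊗ b |-> (v ⊗ b_1) ⊗ b_2 *)
Definition free_hl : {bilin B -> (V ⊗ B)%type -> (V ⊗ B)%type} :=
  bilpre (tbil (lact V) amul) comul.
Definition free_hr : {bilin (V ⊗ B)%type -> B -> (V ⊗ B)%type} :=
  bilinr amul.
Definition free_delta : {linear (V ⊗ B)%type -> (V ⊗ B ⊗ B)%type} :=
  tassocV \o tmap idfun comul.

Lemma free_hrE v b c : free_hr (v ⊗ b) c = v ⊗ (b ∙ c).
Proof. exact: bilinrE. Qed.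

Lemma free_hl1 x : free_hl aone x = x.
Proof.
rewrite /= /bilpre comul1; tens_elim x => v b; tsimp.
by rewrite lact1 amul1l.
Qed.
Lemma free_hlM a b x : free_hl (a ∙ b) x = free_hl a (free_hl b x).
Proof.
rewrite /= /bilpre comulM; apply: tbil_assoc => *.
  exact: lactM.
by rewrite amulA.
Qed.
Lemma free_hr1 x : free_hr x aone = x.
Proof. by tens_elim x => v b; rewrite free_hrE amul1r. Qed.
Lemma free_hrM x a b : free_hr x (a ∙ b) = free_hr (free_hr x a) b.
Proof. by tens_elim x => v c; rewrite !free_hrE amulA. Qed.
Lemma free_tbil_hr (t : B ⊗ B) x b :
  free_hr (tbil (lact V) amul t x) b = tbil (lact V) amul t (free_hr x b).
Proof.
tens_elim x => v c; rewrite free_hrE; tens_elim t => a1 a2; tsimp.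
by rewrite [LHS]bilinrE amulA.
Qed.
Lemma free_hlr a x b : free_hr (free_hl a x) b = free_hl a (free_hr x b).
Proof. exact: free_tbil_hr. Qed.
Lemma free_deltaA x :
  tassoc (tmap free_delta idfun (free_delta x)) = tmap idfun comul (free_delta x).
Proof.
tens_elim x => v b; rewrite /= tmapE /=.
transitivity (tassocV (v ⊗ tassoc (tmap comul idfun (comul b)))); last first.
  rewrite comulA; move: (comul b) => t; tens_elim t => b1 b2; tsimp.
  by move: (comul b2) => t; tens_elim t => b3 b4; tsimp.
move: (comul b) => t; tens_elim t => b1 b2; tsimp.
by move: (comul b1) => t; tens_elim t => b3 b4; tsimp.
Qed.
Lemma free_delta_counit x : trunit (tmap idfun counit (free_delta x)) = x.
Proof.
tens_elim x => v b; rewrite /= tmapE /= -[in RHS](counitr b).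
move: (comul b) => t; tens_elim t => b1 b2; tsimp.
by rewrite bilinZr.
Qed.
Lemma free_delta_act a x b : free_delta (free_hr (free_hl a x) b) =
  tbil free_hr amul (tbil free_hl amul (comul a) (free_delta x)) (comul b).
Proof.
tens_elim x => v c; rewrite free_hlr free_hrE.
rewrite /= tbil_prel [X in _ = tbil _ _ (tbil _ _ _ (tassocV X)) _]tmapE /=.
transitivity (tassocV (tbil (lact V) (tbil amul amul)
  (tmap idfun comul (comul a)) (v ⊗ comul (c ∙ b)))).
  rewrite /bilpre; congr tassocV.
  move: (comul a) => t; tens_elim t => a1 a2; tsimp.
  by rewrite comulM.
rewrite tassocV_tbil -[X in tassocV X]comulA tassocK comulM tassocV_bilinr.
apply/esym/tbil_assoc => *; first exact: free_tbil_hr.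
by rewrite amulA.
Qed.

Definition free_hopfmod : hopfmod B :=
  @HopfModule k B (V ⊗ B)%type free_hl free_hr free_delta free_hl1 free_hlM
    free_hr1 free_hrM free_hlr free_deltaA free_delta_counit free_delta_act.
End Obj.

Section Hom.
Variables (V W : lmodule B) (f : lmodule_hom V W).
Lemma free_hom_l b x : tmap f idfun (hl (free_hopfmod V) b x) =
  hl (free_hopfmod W) b (tmap f idfun x).
Proof.
rewrite /= /bilpre (tmap_tbil (g := lact W) (g' := amul) (a := idfun)
  (a' := idfun) (v := f) (v' := idfun)) ?tmap_id // => *; exact: lfun_act.
Qed.
Lemma free_hom_r x b : tmap f idfun (hr (free_hopfmod V) x b) =
  hr (free_hopfmod W) (tmap f idfun x) b.
Proof. by tens_elim x => v c; rewrite free_hrE !tmapE free_hrE. Qed.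
Lemma free_hom_delta x : delta (free_hopfmod W) (tmap f idfun x) =
  tmap (tmap f idfun) idfun (delta (free_hopfmod V) x).
Proof.
rewrite /= -tassocV_nat !tmap_comp; congr tassocV; apply: eq_tmap => // b /=.
by rewrite tmap_id.
Qed.
Definition free_hom : hopfmod_hom (free_hopfmod V) (free_hopfmod W) :=
  @HopfmodHom k B (free_hopfmod V) (free_hopfmod W) (tmap f idfun)
    free_hom_l free_hom_r free_hom_delta.
End Hom.

Lemma free_hom_id V : free_hom (lhom_id V) = hhom_id (free_hopfmod V).
Proof. by apply: hhom_ext => x /=; rewrite tmap_id. Qed.
Lemma free_hom_comp U V W (f : lmodule_hom V W) (g : lmodule_hom U V) :
  free_hom (lhom_comp f g) = hhom_comp (free_hom f) (free_hom g).
Proof. by apply: hhom_ext => x /=; rewrite tmap_comp; apply: eq_tmap. Qed.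

Definition free_functor : functor (lmodule_cat B) (hopfmod_cat B) :=
  @Functor (lmodule_cat B) (hopfmod_cat B) free_hopfmod free_hom
    free_hom_id free_hom_comp.

Section Phi.
Variables V W : lmodule B.
Local Notation FV := (free_hopfmod V).
Local Notation FW := (free_hopfmod W).
Local Notation FVW := (free_hopfmod (lmodule_tens V W)).

(* (v ⊗ a, y) |-> v ⊗ a y, which for y = w ⊗ b is v ⊗ a_1 w ⊗ a_2 b *)
Definition free_phi_pure (x : FV) (y : FW) : FVW :=
  tassocV (tmap idfun (bilflip (hl FW) y) x).
Lemma free_phi_pureE v a y :
  free_phi_pure (v ⊗ a) y = tassocV (v ⊗ hl FW a y).
Proof. by rewrite /free_phi_pure tmapE. Qed.
Lemma free_phi_pure_l y : linear (free_phi_pure ^~ y).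
Proof. by move=> c x x'; rewrite /free_phi_pure !linearP. Qed.
Lemma free_phi_pure_r x : linear (free_phi_pure x).
Proof.
move=> c y y'; elim/tens_ind: x => [|v a|x x' IH IH'].
- by rewrite /free_phi_pure !lin0E.
- by rewrite !free_phi_pureE bilinDr bilinZr bilinDr bilinZr linearP.
- by move: IH IH'; rewrite /free_phi_pure !linearD /= => -> ->; apply: addrACA.
Qed.
HB.instance Definition _ := isBilin.Build k FV FW FVW free_phi_pure
  free_phi_pure_l free_phi_pure_r.
Lemma free_phi_bal x b y :
  free_phi_pure (hr FV x b) y = free_phi_pure x (hl FW b y).
Proof.
by tens_elim x => v a; rewrite free_hrE !free_phi_pureE hlM.
Qed.
Definition free_phi_fun : hopfmod_tens FV FW -> FVW := blift free_phi_bal.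
HB.instance Definition _ := GRing.Linear.on free_phi_fun.
Lemma free_phi_funE x y : free_phi_fun (btens (hr FV) (hl FW) x y) =
  free_phi_pure x y.
Proof. exact: bliftE. Qed.
Lemma free_phi_funEE v a w b :
  free_phi_fun (btens (hr FV) (hl FW) (v ⊗ a) (w ⊗ b)) =
  tassocV (v ⊗ tbil (lact W) amul (comul a) (w ⊗ b)).
Proof. by rewrite free_phi_funE free_phi_pureE. Qed.

Lemma free_phi_l b x : free_phi_fun (hl (hopfmod_tens FV FW) b x) =
  hl FVW b (free_phi_fun x).
Proof.
btens_elim x => x y; rewrite [X in free_phi_fun X]bt_hlE !free_phi_funE.
tens_elim x => v a; rewrite free_phi_pureE.
transitivity (tassocV (tbil (lact V) (tbil (lact W) amul)
  (tmap idfun comul (comul b)) (v ⊗ hl FW a y))).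
  rewrite -tbil_pre /= {1}/bilpre.
  move: (comul b) => t; tens_elim t => b1 b2; tsimp.
  rewrite [LHS]free_phi_pureE; congr (tassocV (_ ⊗ _)); exact: free_hlM.
by rewrite tassocV_tbil -comulA tassocK -tbil_prel.
Qed.

Lemma free_phi_r x b : free_phi_fun (hr (hopfmod_tens FV FW) x b) =
  hr FVW (free_phi_fun x) b.
Proof.
btens_elim x => x y; rewrite [X in free_phi_fun X]bt_hrE !free_phi_funE.
tens_elim x => v a; rewrite !free_phi_pureE -hlr.
move: (hl FW a y) => z; tens_elim z => w c.
by rewrite free_hrE !tassocVE [RHS]free_hrE.
Qed.

Lemma free_phi_delta x : delta FVW (free_phi_fun x) =
  tmap free_phi_fun idfun (delta (hopfmod_tens FV FW) x).
Proof.
btens_elim x => x y; rewrite [X in tmap _ _ X]bt_deltaE free_phi_funE.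
tens_elim x => v a; rewrite free_phi_pureE.
have -> : delta FVW (tassocV (v ⊗ hl FW a y)) =
    tmap (tassocV \o tensl v) idfun (delta FW (hl FW a y)).
  move: (hl FW a y) => z; tens_elim z => w c; tsimp.
  by move: (comul c) => t; tens_elim t => c1 c2; tsimp.
rewrite delta_l; have -> : delta FV (v ⊗ a) = tassocV (v ⊗ comul a).
  by rewrite /= tmapE.
move: (comul a) (delta FW y) => s t.
tens_elim s => a1 a2; tens_elim t => z b; tsimp.
by rewrite [X in _ = X ⊗ _]free_phi_funE free_phi_pureE.
Qed.

Definition free_phi : hopfmod_hom (hopfmod_tens FV FW) FVW :=
  @HopfmodHom k B (hopfmod_tens FV FW) FVW free_phi_fun
    free_phi_l free_phi_r free_phi_delta.
End Phi.

Section Phi0.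
Local Notation F1 := (free_hopfmod (lmodule_unit B)).
Lemma free_phi0_l (b c : B) : tensl (1 : k^o) (b ∙ c) = hl F1 b (tensl (1 : k^o) c).
Proof.
rewrite /tensl /= /bilpre -[in LHS](counitl b).
move: (comul b) => t; tens_elim t => b1 b2; tsimp.
by rewrite bilinZl bilinZr -bilinZl /counit_act mulr1 /GRing.scale /= mulr1.
Qed.
Lemma free_phi0_r (c b : B) : tensl (1 : k^o) (c ∙ b) = hr F1 (tensl (1 : k^o) c) b.
Proof. by rewrite [RHS]free_hrE. Qed.
Lemma free_phi0_delta (b : B) :
  delta F1 (tensl (1 : k^o) b) = tmap (tensl (1 : k^o)) idfun (comul b).
Proof.
rewrite /tensl /= tmapE /=.
by move: (comul b) => t; tens_elim t => b1 b2; tsimp.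
Qed.
Definition free_phi0 : hopfmod_hom (hopfmod_unit B) F1 :=
  @HopfmodHom k B (hopfmod_unit B) F1 (tensl (1 : k^o))
    free_phi0_l free_phi0_r free_phi0_delta.
End Phi0.
End FreeHopfmod.

Section Sigma.
Variables (k : comPzRingType) (B : bialgType k).

Section Overline.
Variable M : hopfmod B.
(* generators of M B^+ *)
Definition augm_rel (x : M) : Prop :=
  exists (m : M) (b : B), counit b = 0 /\ x = hr M m b.
Definition overline : lmodType k := quot augm_rel.
Definition opi : {linear M -> overline} := qpi augm_rel.

Section Act.
Variable b : B.
Definition olact_pre (m : M) : overline := opi (hl M b m).
Lemma olact_pre_linear : linear olact_pre.
Proof. by move=> c x y; rewrite /olact_pre bilinDr bilinZr linearP. Qed.
HB.instance Definition _ :=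
  GRing.isLinear.Build k M overline _ olact_pre olact_pre_linear.
Lemma olact_pre0 x : augm_rel x -> olact_pre x = 0.
Proof.
move=> [m [c [c0 ->]]]; rewrite /olact_pre -hlr; apply: qpi_eq0.
by exists (hl M b m), c.
Qed.
End Act.
Definition olact (b : B) (x : overline) : overline := qlift (olact_pre0 b) x.
Lemma olactE b m : olact b (opi m) = opi (hl M b m).
Proof. exact: qliftE. Qed.
Lemma olact_l x : linear (olact ^~ x).
Proof.
move=> c a b; elim/quot_ind: x => m; rewrite !(olactE _ m).
by rewrite bilinDl bilinZl linearP.
Qed.
Lemma olact_r b : linear (olact b).
Proof. by move=> c x y; rewrite /olact linearP. Qed.
HB.instance Definition _ := isBilin.Build k B overline overline olact
  olact_l olact_r.
Lemma olact1 x : olact aone x = x.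
Proof. by elim/quot_ind: x => m; rewrite (olactE _ m) hl1. Qed.
Lemma olactM a b x : olact (a ∙ b) x = olact a (olact b x).
Proof. by elim/quot_ind: x => m; rewrite (olactE b m) !olactE hlM. Qed.
Definition overline_lmodule : lmodule B := LeftModule olact1 olactM.
End Overline.

Section HomZmodule.
Variables M N : hopfmod B.
Local Notation homMN := (hopfmod_hom M N).
HB.instance Definition _ := gen_eqMixin homMN.
HB.instance Definition _ := gen_choiceMixin homMN.

Section Ops.
Variables (c : k) (f g : homMN).
Definition hhom_lin_fun (m : M) : N := c *: f m + g m.
Lemma hhom_lin_linear : linear hhom_lin_fun.
Proof.
move=> a x y; rewrite /hhom_lin_fun !linearD !linearZ /= !scalerA (mulrC c a).
by rewrite addrACA.
Qed.
HB.instance Definition _ := GRing.isLinear.Build k M N _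
  hhom_lin_fun hhom_lin_linear.
Lemma hhom_lin_l b m : hhom_lin_fun (hl M b m) = hl N b (hhom_lin_fun m).
Proof. by rewrite /hhom_lin_fun !hfun_l bilinDr bilinZr. Qed.
Lemma hhom_lin_r m b : hhom_lin_fun (hr M m b) = hr N (hhom_lin_fun m) b.
Proof. by rewrite /hhom_lin_fun !hfun_r bilinDl bilinZl. Qed.
Lemma hhom_lin_delta m :
  delta N (hhom_lin_fun m) = tmap hhom_lin_fun idfun (delta M m).
Proof.
rewrite linearP !hfun_delta; move: (delta M m) => x.
elim/tens_ind: x => [|n b|x y]; first by rewrite !lin0E.
- by tsimp; rewrite bilinDl bilinZl.
- by rewrite !linearD /= => <- <-; rewrite addrACA.
Qed.
Definition hhom_lin : homMN := HopfmodHom hhom_lin_l hhom_lin_r hhom_lin_delta.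
End Ops.

Lemma hhom0_l (b : B) (m : M) : (\0 : {linear M -> N}) (hl M b m) = hl N b 0.
Proof. by rewrite bilin0r. Qed.
Lemma hhom0_r (m : M) (b : B) : (\0 : {linear M -> N}) (hr M m b) = hr N 0 b.
Proof. by rewrite bilin0l. Qed.
Lemma hhom0_delta (m : M) :
  delta N 0 = tmap (\0 : {linear M -> N}) idfun (delta M m).
Proof.
rewrite linear0; move: (delta M m) => x.
elim/tens_ind: x => [|n b|x y]; rewrite ?linear0 ?tmapE ?bilin0l //.
by rewrite linearD /= => <- <-; rewrite addr0.
Qed.
Definition hhom0 : homMN :=
  @HopfmodHom k B M N (\0 : {linear M -> N}) hhom0_l hhom0_r hhom0_delta.

Definition hhom_add (f g : homMN) := hhom_lin 1 f g.
Definition hhom_opp (f : homMN) := hhom_lin (-1) f hhom0.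
Definition hhom_scale (c : k) (f : homMN) := hhom_lin c f hhom0.

Lemma hhom_addA : associative hhom_add.
Proof.
move=> f g h; apply: hhom_ext => m; rewrite /= /hhom_lin_fun /= /hhom_lin_fun.
by rewrite !scale1r addrA.
Qed.
Lemma hhom_addC : commutative hhom_add.
Proof.
by move=> f g; apply: hhom_ext => m; rewrite /= /hhom_lin_fun !scale1r addrC.
Qed.
Lemma hhom_add0 : left_id hhom0 hhom_add.
Proof. by move=> f; apply: hhom_ext => m; rewrite /= /hhom_lin_fun scale1r add0r. Qed.
Lemma hhom_addN : left_inverse hhom0 hhom_opp hhom_add.
Proof.
move=> f; apply: hhom_ext => m; rewrite /= /hhom_lin_fun /= /hhom_lin_fun /=.
by rewrite scale1r addr0 scaleN1r addNr.
Qed.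
HB.instance Definition _ := GRing.isZmodule.Build homMN
  hhom_addA hhom_addC hhom_add0 hhom_addN.
Lemma hhom_addE (f g : homMN) m : (f + g) m = f m + g m.
Proof. by rewrite /= /hhom_lin_fun scale1r. Qed.

Lemma hhom_scaleE c f m : hhom_scale c f m = c *: f m.
Proof. by rewrite /= /hhom_lin_fun addr0. Qed.
Lemma hhom_scaleA a b f : hhom_scale a (hhom_scale b f) = hhom_scale (a * b) f.
Proof. by apply: hhom_ext => m; rewrite !hhom_scaleE scalerA. Qed.
Lemma hhom_scale1 : left_id 1 hhom_scale.
Proof. by move=> f; apply: hhom_ext => m; rewrite hhom_scaleE scale1r. Qed.
Lemma hhom_scaleDr : right_distributive hhom_scale +%R.
Proof.
by move=> a f g; apply: hhom_ext => m; rewrite !(hhom_addE,hhom_scaleE) scalerDr.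
Qed.
Lemma hhom_scaleDl f : {morph hhom_scale^~ f : a b / a + b}.
Proof.
by move=> a b; apply: hhom_ext => m; rewrite !(hhom_addE,hhom_scaleE) scalerDl.
Qed.
HB.instance Definition _ := GRing.Zmodule_isLmodule.Build k homMN
  hhom_scaleA hhom_scale1 hhom_scaleDr hhom_scaleDl.
Lemma hhom_scalerE c (f : homMN) m : (c *: f) m = c *: f m.
Proof. exact: hhom_scaleE. Qed.
End HomZmodule.

Local Notation BB := (free_hopfmod (regular_lmodule B)).

Section HomModule.
Variable M : hopfmod B.

(* (b . f)(x ⊗ y) = f (x b ⊗ y) *)
Definition homlact (b : B) (f : hopfmod_hom BB M) : hopfmod_hom BB M :=
  hhom_comp f (free_hom (rmul b)).
Lemma homlactE b f x y : homlact b f (x ⊗ y) = f ((x ∙ b) ⊗ y).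
Proof. by rewrite /= tmapE. Qed.
Lemma hhomBB_ext (f g : hopfmod_hom BB M) :
  (forall x y, f (x ⊗ y) = g (x ⊗ y)) -> f = g.
Proof. by move=> e; apply/hhom_ext/tens_ext2. Qed.
Lemma homlact_l f : linear (homlact ^~ f).
Proof.
move=> c a b; apply: hhomBB_ext => x y.
by rewrite hhom_addE hhom_scalerE !homlactE bilinDr bilinZr bilinDl bilinZl linearP.
Qed.
Lemma homlact_r b : linear (homlact b).
Proof.
move=> c f g; apply: hhomBB_ext => x y.
by rewrite !(hhom_addE, hhom_scalerE, homlactE).
Qed.
HB.instance Definition _ := isBilin.Build k B (hopfmod_hom BB M) (hopfmod_hom BB M)
  homlact homlact_l homlact_r.
Lemma homlact1 f : homlact aone f = f.
Proof. by apply: hhomBB_ext => x y; rewrite homlactE amul1r. Qed.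
Lemma homlactM a b f : homlact (a ∙ b) f = homlact a (homlact b f).
Proof. by apply: hhomBB_ext => x y; rewrite !homlactE amulA. Qed.
Definition hom_lmodule : lmodule B := LeftModule homlact1 homlactM.

Definition sigma_fun (f : hom_lmodule) : overline_lmodule M :=
  opi M ((f : hopfmod_hom BB M) (aone ⊗ aone)).
Lemma sigma_linear : linear sigma_fun.
Proof. by move=> c f g; rewrite /sigma_fun hhom_addE hhom_scalerE linearP. Qed.
HB.instance Definition _ := GRing.isLinear.Build k hom_lmodule
  (overline_lmodule M) _ sigma_fun sigma_linear.

Lemma opi_hr (m : M) (b : B) : opi M (hr M m b) = (counit b : k) *: opi M m.
Proof.
rewrite -linearZ /=; apply/qpiP/span_gen.
exists m, (b - (counit b : k) *: aone); split.
- rewrite linearB linearZ /= counit1; apply/eqP; rewrite subr_eq0.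
  by apply/eqP/esym/mulr1.
- by rewrite bilinDr bilinNr bilinZr hr1.
Qed.

Lemma sigma_act (b : B) (f : hom_lmodule) :
  sigma_fun (lact hom_lmodule b f) = lact (overline_lmodule M) b (sigma_fun f).
Proof.
rewrite /sigma_fun [RHS]olactE -hfun_l.
rewrite [X in opi M X = _]homlactE amul1l.
have opiE (x y : B) : opi M (f (x ⊗ y)) = (counit y : k) *: opi M (f (x ⊗ aone)).
  by rewrite -opi_hr -hfun_r [hr BB _ _]free_hrE amul1l.
rewrite /= /bilpre -{1}[b]counitr.
move: (comul b) => t; tens_elim t => b1 b2; tsimp.
by rewrite bilinZl !linearZ /= !amul1r [RHS]opiE.
Qed.
Definition sigma : lmodule_hom hom_lmodule (overline_lmodule M) :=
  LmoduleHom sigma_act.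
End HomModule.
End Sigma.

(* Main.v *)
(** Write L M = M/MB^+, R M = Hom(B ⊗ B, M) and F V = V ⊗ B. For every bialgebra
    F is fully faithful and strong monoidal, and L ⊣ F ⊣ R; moreover sigma is
    determined by F sigma = eta gamma, where eta m = [m_0] ⊗ m_1 and
    gamma (f ⊗ b) = f (1 ⊗ b) are the unit of L ⊣ F and the counit of F ⊣ R.
    With an antipode S, eta has the inverse [m] ⊗ b |-> m_0 S(m_1) b, so F is an
    equivalence, hence Frobenius. If G is both a left and a right adjoint of F,
    full faithfulness of F makes the composite of unit and counit through F G
    invertible, hence also eta gamma and sigma.

    Conversely, let sigma be invertible and let f : B ⊗ B -> M be the map with
    sigma f = [1 ⊗ 1], where M = B ⊗ B has the diagonal right action, the left
    action on the second factor and the coaction of the second factor.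
    Then f (b ⊗ 1) = S(b) ⊗ 1 for some S, and with e = S(1) one gets
    S(a_1) a_2 = eps(a) e = a_1 S(a_2). Hence e is central, as both a e and e a
    equal a_1 S(a_2) a_3. Finally, for the diagonal left action on M the
    maps x ⊗ y |-> eps(x) (y_1 ⊗ y_2) and x ⊗ y |-> eps(x) (e y_1 ⊗ y_2) have the
    same image [1 ⊗ 1] = [e ⊗ 1] under sigma, so that e = 1. *)

Require Import Defs.
From HB Require Import structures.
From mathcomp Require Import all_boot all_algebra.
From mathcomp Require Import boolp.
Import Defs.

Set Implicit Arguments.
Unset Strict Implicit.
Unset Printing Implicit Defensive.

Import GRing.Theory.
Local Open Scope ring_scope.

(** * Equivalences and Frobenius functors *)

Section Isomorphisms.
Variable C : category.

Lemma is_iso_id (a : C) : is_iso (idm a).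
Proof. by exists (idm a); rewrite compidl. Qed.

Lemma is_iso_comp (a b c : C) (f : hom b c) (g : hom a b) :
  is_iso f -> is_iso g -> is_iso (comp f g).
Proof.
move=> [f' [f'f ff']] [g' [g'g gg']]; exists (comp g' f'); split.
  by rewrite -compA (compA f') f'f compidl.
by rewrite -compA (compA g) gg' compidl.
Qed.

Lemma is_iso_cancelr (a b c : C) (f : hom b c) (g : hom a b) :
  is_iso (comp f g) -> is_iso g -> is_iso f.
Proof.
move=> fg_iso [g' [g'g gg']].
rewrite -[f]compidr -gg' compA; apply: is_iso_comp => //.
by exists g.
Qed.

Lemma is_iso_sect (a b : C) (f : hom a b) (g : hom b a) :
  is_iso f -> comp g f = idm a -> is_iso g.
Proof.
by move=> fi gf; apply: is_iso_cancelr fi; rewrite gf; apply: is_iso_id.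
Qed.

Lemma is_iso_retr (a b : C) (f : hom a b) (g : hom b a) :
  is_iso f -> comp f g = idm b -> is_iso g.
Proof.
move=> [f' [f'f ff']] fg.
have -> : g = f' by rewrite -[g]compidl -f'f -compA fg compidr.
by exists f.
Qed.

Lemma is_iso_epi (a b c : C) (f : hom a b) (g h : hom b c) :
  is_iso f -> comp g f = comp h f -> g = h.
Proof.
by move=> [f' [_ ff']] e; rewrite -[g]compidr -[h]compidr -ff' !compA e.
Qed.

Lemma is_iso_mono (a b c : C) (f : hom b c) (g h : hom a b) :
  is_iso f -> comp f g = comp f h -> g = h.
Proof.
by move=> [f' [f'f _]] e; rewrite -[g]compidl -[h]compidl -f'f -!compA e.
Qed.
End Isomorphisms.

Section Functors.
Variables C D : category.
Implicit Type F : functor C D.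

Definition faithful F := forall (a b : C) (f g : hom a b),
  fmap F f = fmap F g -> f = g.
Definition full F := forall (a b : C) (h : hom (F a) (F b)),
  exists f : hom a b, fmap F f = h.

Lemma fmap_iso F (a b : C) (f : hom a b) : is_iso f -> is_iso (fmap F f).
Proof.
by move=> [g [gf fg]]; exists (fmap F g); rewrite -!fmap_comp gf fg !fmap_id.
Qed.

Lemma fmap_reflect_iso F (a b : C) (f : hom a b) :
  faithful F -> full F -> is_iso (fmap F f) -> is_iso f.
Proof.
move=> Ffaith Ffull [h [hf fh]]; have [g Fg] := Ffull _ _ h.
by exists g; split; apply: Ffaith; rewrite fmap_comp Fg ?hf ?fh fmap_id.
Qed.

Lemma natural_inv (F G : functor C D) (t : forall a, hom (F a) (G a))
  (u : forall a, hom (G a) (F a)) :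
  natural t -> (forall a, comp (u a) (t a) = idm (F a)) ->
  (forall a, comp (t a) (u a) = idm (G a)) -> natural u.
Proof.
move=> t_nat ut tu a b f.
rewrite -[LHS]compidr -(tu a) -(compA (u b)) (compA (fmap G f)) -t_nat.
by rewrite -(compA (t b)) (compA (u b)) ut compidl.
Qed.
End Functors.

Section RetractionFaithful.
Variables (C D : category) (F : functor C D) (G : functor D C).
Variable s : forall a, hom (compF G F a) (idF C a).
Hypotheses (s_nat : natural s) (s_iso : forall a, is_iso (s a)).

(** By naturality [f] after [s a] equals [s b] after [G (F f)], and [s a] is epi, so [F f]
    determines [f]. *)
Lemma faithful_of_retraction : faithful F.
Proof.
move=> a b f g e; apply: (is_iso_epi (s_iso a)).
have /= <- := s_nat f; have /= <- := s_nat g; by rewrite e.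
Qed.
End RetractionFaithful.

Lemma adjoint_of_nat_iso (C D : category) (F : functor C D) (G : functor D C) :
  nat_iso (compF G F) (idF C) -> nat_iso (compF F G) (idF D) -> adjoint F G.
Proof.
move=> [s [s_nat s_iso]] [t [t_nat t_iso]].
have Ff := faithful_of_retraction s_nat s_iso.
have Gf := faithful_of_retraction t_nat t_iso.
pose s' a : hom a (G (F a)) := projT1 (cid (s_iso a)).
pose t' b : hom b (F (G b)) := projT1 (cid (t_iso b)).
have s's a : comp (s' a) (s a) = idm _ by have [] := projT2 (cid (s_iso a)).
have ss' a : comp (s a) (s' a) = idm _ by have [] := projT2 (cid (s_iso a)).
have t't b : comp (t' b) (t b) = idm _ by have [] := projT2 (cid (t_iso b)).
(* With [s'] as unit, [t] itself need not satisfy the triangle identities. This correction of [t]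
   gives [G eps = s G]. As [G] is faithful, naturality of [eps] and both triangle identities become
   properties of [s]. *)
pose eps b : hom (F (G b)) b :=
  comp (t b) (comp (fmap F (s (G b))) (t' (F (G b)))).
have Geps b : fmap G (eps b) = s (G b).
  apply/Ff/(is_iso_mono (t_iso b)); have /= -> := t_nat _ _ (eps b).
  rewrite /eps -!compA; congr comp.
  by have /= -> := t't (F (G b)); rewrite compidr.
exists s', eps; move: eps Geps => eps Geps; split.
- exact: natural_inv s_nat s's ss'.
- move=> b c f; apply: Gf; rewrite /= !fmap_comp !Geps; exact: s_nat.
- move=> a; apply: Gf; rewrite /= fmap_comp Geps fmap_id.
  have /= -> := s_nat _ _ (s' a); exact: s's.
- by move=> b; rewrite /= Geps; apply: ss'.
Qed.

(** The data of an equivalence are symmetric in [F] and [G], so the same construction yields both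
    adjunctions. *)
Lemma equivalence_frobenius (C D : category) (F : functor C D) :
  is_equivalence F -> is_frobenius F.
Proof.
by move=> [G [GF FG]]; exists G; split; apply: adjoint_of_nat_iso.
Qed.

(** * Adjunctions as universal arrows *)

Section UniversalArrows.
Variables (C D : category) (F : functor C D).

(** Universal arrows allow adjunctions to be compared one object at a time; thus
    [M |-> Hom(B ⊗ B, M)] need not be made a functor. *)
Definition universal_from (M : D) (L : C) (e : hom M (F L)) : Prop :=
  forall (V : C) (h : hom M (F V)), exists g : hom L V,
    comp (fmap F g) e = h /\ forall g', comp (fmap F g') e = h -> g' = g.

Definition universal_to (M : D) (R : C) (c : hom (F R) M) : Prop :=
  forall (V : C) (h : hom (F V) M), exists g : hom V R,
    comp c (fmap F g) = h /\ forall g', comp c (fmap F g') = h -> g' = g.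

Lemma universal_from_unique (M : D) (L L' : C) (e : hom M (F L))
    (e' : hom M (F L')) : universal_from e -> universal_from e' ->
  exists2 i : hom L L', is_iso i & comp (fmap F i) e = e'.
Proof.
move=> eP e'P; have [i [ie _]] := eP _ e'; have [j [je' _]] := e'P _ e.
exists i => //; exists j; split.
  have [g [_ gP]] := eP _ e; rewrite (gP (idm L)) ?fmap_id ?compidl //.
  by apply: gP; rewrite fmap_comp -compA ie je'.
have [g [_ gP]] := e'P _ e'; rewrite (gP (idm L')) ?fmap_id ?compidl //.
by apply: gP; rewrite fmap_comp -compA je' ie.
Qed.

Lemma universal_to_unique (M : D) (R R' : C) (c : hom (F R) M)
    (c' : hom (F R') M) : universal_to c -> universal_to c' ->
  exists2 i : hom R R', is_iso i & comp c' (fmap F i) = c.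
Proof.
move=> cP c'P; have [i [ic' _]] := c'P _ c; have [j [jc _]] := cP _ c'.
exists i => //; exists j; split.
  have [g [_ gP]] := cP _ c; rewrite (gP (idm R)) ?fmap_id ?compidr //.
  by apply: gP; rewrite fmap_comp compA jc ic'.
have [g [_ gP]] := c'P _ c'; rewrite (gP (idm R')) ?fmap_id ?compidr //.
by apply: gP; rewrite fmap_comp compA ic' jc.
Qed.

Section LeftAdjoint.
Variables (L : functor D C) (eta : forall M, hom (idF D M) (compF F L M))
  (nu : forall V, hom (compF L F V) (idF C V)).
Hypotheses (eta_nat : natural eta) (nu_nat : natural nu).
Hypothesis triangleL : forall M, comp (nu (L M)) (fmap L (eta M)) = idm (L M).
Hypothesis triangleF : forall V, comp (fmap F (nu V)) (eta (F V)) = idm (F V).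

Lemma unit_universal M : universal_from (eta M).
Proof.
move=> V h; exists (comp (nu V) (fmap L h)); split.
  rewrite fmap_comp -compA; have /= <- := eta_nat h.
  by rewrite compA triangleF compidl.
move=> g <-; rewrite fmap_comp compA; have /= -> := nu_nat g.
by rewrite -compA triangleL compidr.
Qed.

(** Every [h : F V -> F W] is [F g] after [eta (F V)], and the triangle identity makes [eta (F V)]
    the image of the inverse of [nu V]. *)
Lemma counit_iso_full : (forall V, is_iso (nu V)) -> full F.
Proof.
move=> nu_iso V W h; have [g [gh _]] := unit_universal h.
have [nu' [_ nunu']] := nu_iso V; exists (comp g nu').
rewrite -gh fmap_comp; congr comp; apply: (is_iso_mono (fmap_iso F (nu_iso V))).
by have /= -> := triangleF V; rewrite -fmap_comp nunu' fmap_id.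
Qed.

(** A preimage of [eta (F V)] under [F] inverts [nu V]: on one side by faithfulness and the triangle
    identity, on the other by universality of the unit. *)
Lemma full_counit_iso : faithful F -> full F -> forall V, is_iso (nu V).
Proof.
move=> Ff FF V; have [g Fg] := FF _ _ (eta (F V)); exists g; split; last first.
  by apply: Ff; rewrite fmap_comp Fg triangleF fmap_id.
have [u [_ uP]] := unit_universal (eta (F V)).
rewrite (uP (idm _)) ?fmap_id ?compidl //; apply: uP.
by rewrite fmap_comp Fg -compA triangleF compidr.
Qed.
End LeftAdjoint.

Section RightAdjoint.
Variables (R : functor D C) (theta : forall V, hom (idF C V) (compF R F V))
  (gam : forall M, hom (compF F R M) (idF D M)).
Hypotheses (theta_nat : natural theta) (gam_nat : natural gam).
Hypothesis triangleF :
  forall V, comp (gam (F V)) (fmap F (theta V)) = idm (F V).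
Hypothesis triangleR :
  forall M, comp (fmap R (gam M)) (theta (R M)) = idm (R M).

Lemma counit_universal M : universal_to (gam M).
Proof.
move=> V h; exists (comp (fmap R h) (theta V)); split.
  rewrite fmap_comp compA; have /= -> := gam_nat h.
  by rewrite -compA triangleF compidr.
move=> g <-; rewrite fmap_comp -compA; have /= <- := theta_nat g.
by rewrite compA triangleR compidl.
Qed.

(** Dually, a preimage of [gam (F V)] under [F] inverts [theta V]. *)
Lemma full_unit_iso : faithful F -> full F -> forall V, is_iso (theta V).
Proof.
move=> Ff FF V; have [g Fg] := FF _ _ (gam (F V)); exists g; split.
  by apply: Ff; rewrite fmap_comp Fg triangleF fmap_id.
have [u [_ uP]] := counit_universal (gam (F V)).
rewrite (uP (idm _)) ?fmap_id ?compidr //; apply: uP.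
by rewrite fmap_comp Fg compA triangleF compidl.
Qed.
End RightAdjoint.

(* For a common left and right adjoint [G], [eta M] after [gam M] equals
   [fmap F (fmap G (gam M))] after [eta (F (G M))], and both factors are
   inverse to images of components of the invertible unit and counit. *)
Lemma frobenius_unit_counit_iso (M : D) (L R : C) (e : hom M (F L))
    (c : hom (F R) M) (s : hom R L) :
  faithful F -> full F -> is_frobenius F ->
  universal_from e -> universal_to c -> fmap F s = comp e c -> is_iso s.
Proof.
move=> Ff FF [G [[eta [nu [eta_nat nu_nat trG trF]]]
  [theta [gam [theta_nat gam_nat trF' trG']]]]] eP cP sE.
apply: (fmap_reflect_iso Ff FF); rewrite sE.
have [i i_iso <-] :=
  universal_from_unique (unit_universal eta_nat nu_nat trG trF (M := M)) eP.
have [j j_iso <-] := universal_to_unique cP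
  (counit_universal theta_nat gam_nat trF' trG' (M := M)).
rewrite -compA; apply: is_iso_comp; first exact: fmap_iso.
rewrite compA; apply: is_iso_comp; last exact: fmap_iso.
have /= -> := eta_nat _ _ (gam M); apply: is_iso_comp.
  apply/fmap_iso/(is_iso_sect _ (trG' M)).
  exact: full_unit_iso theta_nat gam_nat trF' trG' Ff FF _.
apply: is_iso_retr (trF (G M)).
apply/fmap_iso; exact: full_counit_iso eta_nat nu_nat trG trF Ff FF _.
Qed.
End UniversalArrows.

(** * The left adjoint of the free Hopf module functor *)

Section Overline.
Variables (k : comPzRingType) (B : bialgType k).
Implicit Types (M N : hopfmod B) (V W : lmodule B).

Section Hom.
Variables (M N : hopfmod B) (f : hopfmod_hom M N).
Lemma overline_hom_augm x : augm_rel x -> (opi N \o f) x = 0.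
Proof.
by move=> [m [b [b0 ->]]]; apply: qpi_eq0; exists (f m), b; rewrite hfun_r.
Qed.
Definition overline_hom_fun : overline M -> overline N :=
  qlift overline_hom_augm.
HB.instance Definition _ := GRing.Linear.on overline_hom_fun.
Lemma overline_hom_funE m : overline_hom_fun (opi M m) = opi N (f m).
Proof. exact: qliftE. Qed.
Lemma overline_hom_act b x :
  overline_hom_fun (lact (overline_lmodule M) b x) =
  lact (overline_lmodule N) b (overline_hom_fun x).
Proof.
elim/quot_ind: x => m; rewrite [lact _ _ _]olactE !overline_hom_funE.
by rewrite hfun_l [RHS]olactE.
Qed.
Definition overline_hom :
    lmodule_hom (overline_lmodule M) (overline_lmodule N) :=
  @LmoduleHom k B (overline_lmodule M) (overline_lmodule N) overline_hom_fun
    overline_hom_act.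
End Hom.

Lemma overline_hom_id M :
  overline_hom (hhom_id M) = lhom_id (overline_lmodule M).
Proof.
by apply: lhom_ext; elim/quot_ind => m; rewrite [LHS]overline_hom_funE.
Qed.
Lemma overline_hom_comp M N P (f : hopfmod_hom N P) (g : hopfmod_hom M N) :
  overline_hom (hhom_comp f g) = lhom_comp (overline_hom f) (overline_hom g).
Proof.
apply: lhom_ext; elim/quot_ind => m; rewrite /= [LHS]overline_hom_funE.
by rewrite (overline_hom_funE g) (overline_hom_funE f).
Qed.

Definition overline_functor : functor (hopfmod_cat B) (lmodule_cat B) :=
  @Functor (hopfmod_cat B) (lmodule_cat B) (@overline_lmodule k B) overline_hom
    overline_hom_id overline_hom_comp.

Section Unit.
Variable M : hopfmod B.
Local Notation FM := (free_hopfmod (overline_lmodule M)).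
Definition overline_eta_fun (m : M) : FM := tmap (opi M) idfun (delta M m).
HB.instance Definition _ := GRing.Linear.copy overline_eta_fun
  (tmap (opi M) idfun \o delta M).
Lemma overline_eta_l b m :
  overline_eta_fun (hl M b m) = hl FM b (overline_eta_fun m).
Proof.
rewrite /overline_eta_fun delta_l /= /bilpre.
rewrite (tmap_tbil (g := lact (overline_lmodule M)) (g' := amul)
  (a := idfun) (a' := idfun) (v := opi M) (v' := idfun)) ?tmap_id //.
by move=> a x; rewrite [RHS]olactE.
Qed.
(** Modulo [M B^+], [m_0 b_1] is [eps(b_1) m_0], and [eps(b_1) b_2 = b] remains in the second
    factor. *)
Lemma overline_eta_r m b :
  overline_eta_fun (hr M m b) = hr FM (overline_eta_fun m) b.
Proof.
rewrite /overline_eta_fun delta_r.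
have -> (x : M ⊗ B) (y : B ⊗ B) : tmap (opi M) idfun (tbil (hr M) amul x y) =
    hr FM (tmap (opi M) idfun x) (tlunit (tmap counit idfun y)).
  tens_elim x => n c; tens_elim y => d e; tsimp.
  by rewrite [RHS]bilinrE -[qpi _ _]/(opi M _) opi_hr bilinZl bilinZr bilinZr.
by rewrite counitl.
Qed.
Lemma overline_eta_delta m :
  delta FM (overline_eta_fun m) = tmap overline_eta_fun idfun (delta M m).
Proof.
rewrite /overline_eta_fun /= tmap_comp.
transitivity (tassocV (tmap (opi M) (tmap idfun idfun)
  (tmap idfun comul (delta M m)))).
  rewrite tmap_comp; congr tassocV.
  by apply: eq_tmap => // b /=; rewrite tmap_id.
rewrite -deltaA tassocV_nat tassocK tmap_comp; exact: eq_tmap.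
Qed.
Definition overline_eta : hopfmod_hom M FM :=
  @HopfmodHom k B M FM overline_eta_fun
    overline_eta_l overline_eta_r overline_eta_delta.
End Unit.

Section Counit.
Variable V : lmodule B.
Local Notation FV := (free_hopfmod V).
Definition free_counit : {linear FV -> V} := trunit \o tmap idfun counit.
Lemma free_counitE v b : free_counit (v ⊗ b) = (counit b : k) *: v.
Proof. by rewrite /free_counit /= tmapE trunitE. Qed.
Lemma free_counit_r x b :
  free_counit (hr FV x b) = (counit b : k) *: free_counit x.
Proof.
tens_elim x => v c; rewrite [hr _ _ _]free_hrE !free_counitE counitM.
by rewrite scalerA mulrC.
Qed.
Lemma free_counit_augm x : augm_rel x -> free_counit x = 0.
Proof. by move=> [y [b [b0 ->]]]; rewrite free_counit_r b0 scale0r. Qed.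
Lemma free_counit_l b x : free_counit (hl FV b x) = lact V b (free_counit x).
Proof.
tens_elim x => v c; rewrite free_counitE -{2}(counitr b) /= /bilpre.
move: (comul b) => t; tens_elim t => b1 b2; tsimp.
by rewrite counitM bilinZl bilinZr scalerA.
Qed.
Definition overline_nu_fun : overline FV -> V := qlift free_counit_augm.
HB.instance Definition _ := GRing.Linear.on overline_nu_fun.
Lemma overline_nu_funE x : overline_nu_fun (opi FV x) = free_counit x.
Proof. exact: qliftE. Qed.
Lemma overline_nu_act b x :
  overline_nu_fun (lact (overline_lmodule FV) b x) =
  lact V b (overline_nu_fun x).
Proof.
elim/quot_ind: x => x; rewrite [lact _ _ _]olactE !overline_nu_funE.
exact: free_counit_l.
Qed.
Definition overline_nu : lmodule_hom (overline_lmodule FV) V :=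
  @LmoduleHom k B (overline_lmodule FV) V overline_nu_fun overline_nu_act.

(** Since [v ⊗ b = (v ⊗ 1) b], the class of [v ⊗ b] is [eps(b) [v ⊗ 1]]. *)
Lemma overline_nuK : cancel overline_nu (opi FV \o tensr (aone : B)).
Proof.
elim/quot_ind=> x; rewrite [overline_nu _]overline_nu_funE -/(opi FV x).
tens_elim x => v b; rewrite free_counitE linearZ /=.
by rewrite /tensr -opi_hr [hr _ _ _]free_hrE amul1l.
Qed.
Lemma overline_nuVK : cancel (opi FV \o tensr (aone : B)) overline_nu.
Proof.
move=> v; rewrite [LHS]overline_nu_funE /tensr free_counitE counit1.
by rewrite scale1r.
Qed.
Lemma overline_nu_iso :
  is_iso (overline_nu : @hom (lmodule_cat B) (overline_lmodule FV) V).
Proof. exact: lhom_iso overline_nuK overline_nuVK. Qed.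
End Counit.

Local Notation L := overline_functor.
Local Notation F := (free_functor B).

Lemma overline_eta_natural :
  natural (F := idF _) (G := compF F L) overline_eta.
Proof.
move=> M N f; apply: hhom_ext => m /=; rewrite /overline_eta_fun hfun_delta.
rewrite !tmap_comp; apply: eq_tmap => // n /=.
by rewrite overline_hom_funE.
Qed.

Lemma overline_nu_natural :
  natural (F := compF L F) (G := idF _) overline_nu.
Proof.
move=> V W f; apply: lhom_ext; elim/quot_ind => x /=.
rewrite (overline_hom_funE (free_hom f)) !overline_nu_funE /=.
by tens_elim x => v b; tsimp; rewrite linearZ.
Qed.

Lemma overline_triangle M :
  lhom_comp (overline_nu (overline_lmodule M)) (overline_hom (overline_eta M)) =
  lhom_id (overline_lmodule M).
Proof.
apply: lhom_ext; elim/quot_ind => m /=.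
rewrite (overline_hom_funE (overline_eta M)) overline_nu_funE.
rewrite -/(opi M m) -[in RHS](delta_counit m) /= /overline_eta_fun.
move: (delta M m) => x; tens_elim x => n b; tsimp.
by rewrite linearZ.
Qed.

Lemma free_triangle V :
  hhom_comp (free_hom (overline_nu V)) (overline_eta (free_hopfmod V)) =
  hhom_id (free_hopfmod V).
Proof.
apply/hhom_ext/tens_ext2 => v b /=; rewrite /overline_eta_fun /= tmapE /=.
rewrite tmap_comp -[in RHS](counitl b).
move: (comul b) => t; tens_elim t => b1 b2; tsimp.
by rewrite overline_nu_funE free_counitE bilinZl bilinZr.
Qed.

Lemma free_functor_faithful : faithful F.
Proof. exact: faithful_of_retraction overline_nu_natural overline_nu_iso. Qed.

Lemma free_functor_full : full F.
Proof.
exact: counit_iso_full overline_eta_natural overline_nu_natural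
  overline_triangle free_triangle overline_nu_iso.
Qed.

Lemma overline_eta_universal M :
  universal_from (F := F) (M := M) (L := overline_lmodule M) (overline_eta M).
Proof.
exact: unit_universal overline_eta_natural overline_nu_natural
  overline_triangle free_triangle M.
Qed.
End Overline.

(** * The right adjoint and sigma *)

Section HomCounit.
Variables (k : comPzRingType) (B : bialgType k).
Local Notation F := (free_functor B).
Local Notation BB := (free_hopfmod (regular_lmodule B)).

Section Eval.
Variable M : hopfmod B.
Local Notation FH := (free_hopfmod (hom_lmodule M)).

Definition hom_eval_pure (f : hom_lmodule M) (b : B) : M := f (aone ⊗ b).
Lemma hom_eval_pure_l b : linear (hom_eval_pure ^~ b).
Proof. by move=> c f g; rewrite /hom_eval_pure hhom_addE hhom_scalerE. Qed.
Lemma hom_eval_pure_r f : linear (hom_eval_pure f).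
Proof. by move=> c x y; rewrite /hom_eval_pure bilinDr bilinZr linearP. Qed.
HB.instance Definition _ := isBilin.Build k (hom_lmodule M) B M hom_eval_pure
  hom_eval_pure_l hom_eval_pure_r.
Definition hom_eval_fun : FH -> M := tlift hom_eval_pure.
HB.instance Definition _ := GRing.Linear.on hom_eval_fun.
Lemma hom_eval_funE f b : hom_eval_fun (f ⊗ b) = f (aone ⊗ b).
Proof. exact: tliftE. Qed.

(** [(b_1 . f)(1 ⊗ b_2 c) = f (b_1 ⊗ b_2 c) = f (b (1 ⊗ c))]. *)
Lemma hom_eval_l b x : hom_eval_fun (hl FH b x) = hl M b (hom_eval_fun x).
Proof.
tens_elim x => f c; rewrite hom_eval_funE -hfun_l /= /bilpre.
move: (comul b) => t; tens_elim t => b1 b2; rewrite !tbilE hom_eval_funE.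
by rewrite [LHS]homlactE amul1l /= amul1r.
Qed.
Lemma hom_eval_r x b : hom_eval_fun (hr FH x b) = hr M (hom_eval_fun x) b.
Proof.
tens_elim x => f c; rewrite [hr FH _ _]free_hrE !hom_eval_funE -hfun_r.
by rewrite [hr BB _ _]free_hrE.
Qed.
Lemma hom_eval_delta x :
  delta M (hom_eval_fun x) = tmap hom_eval_fun idfun (delta FH x).
Proof.
tens_elim x => f b; rewrite hom_eval_funE hfun_delta /= !tmapE /=.
move: (comul b) => t; tens_elim t => b1 b2.
by rewrite !tassocVE !tmapE /= hom_eval_funE.
Qed.
Definition hom_eval : hopfmod_hom FH M :=
  @HopfmodHom k B FH M hom_eval_fun hom_eval_l hom_eval_r hom_eval_delta.
End Eval.

Section Orbit.
Variables (V : lmodule B) (v : V).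
Lemma lact_orbit_act (b x : B) :
  bilflip (lact V) v (b ∙ x) = lact V b (bilflip (lact V) v x).
Proof. exact: lactM. Qed.
Definition lact_orbit : lmodule_hom (regular_lmodule B) V :=
  @LmoduleHom k B (regular_lmodule B) V (bilflip (lact V) v) lact_orbit_act.
End Orbit.

Section Transpose.
Variables (M : hopfmod B) (V : lmodule B) (h : hopfmod_hom (free_hopfmod V) M).
Definition transpose_fun (v : V) : hom_lmodule M :=
  hhom_comp h (free_hom (lact_orbit v)).
Lemma transpose_funE v x y :
  (transpose_fun v : hopfmod_hom BB M) (x ⊗ y) = h (lact V x v ⊗ y).
Proof. by rewrite /= tmapE. Qed.
Lemma transpose_linear : linear transpose_fun.
Proof.
move=> c v w; apply: hhomBB_ext => x y.
rewrite hhom_addE hhom_scalerE !transpose_funE bilinDr bilinZr.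
by rewrite bilinDl bilinZl linearP.
Qed.
HB.instance Definition _ := GRing.isLinear.Build k V (hom_lmodule M) _
  transpose_fun transpose_linear.
Lemma transpose_act b v :
  transpose_fun (lact V b v) = lact (hom_lmodule M) b (transpose_fun v).
Proof.
apply: hhomBB_ext => x y.
by rewrite transpose_funE [RHS]homlactE transpose_funE lactM.
Qed.
Definition transpose : lmodule_hom V (hom_lmodule M) :=
  @LmoduleHom k B V (hom_lmodule M) transpose_fun transpose_act.
End Transpose.

(** The map [h] corresponds to [v |-> (x ⊗ y |-> h (x v ⊗ y))]. It is the only choice, because [g v
    (x ⊗ y) = (x . g v)(1 ⊗ y) = g (x v) (1 ⊗ y)] by linearity of [g]. *)
Lemma hom_eval_universal (M : hopfmod B) :
  universal_to (F := F) (M := M) (R := hom_lmodule M) (hom_eval M).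
Proof.
move=> V h; exists (transpose h); split.
  apply/hhom_ext/tens_ext2 => v b /=.
  by rewrite tmapE [LHS]hom_eval_funE transpose_funE lact1.
move=> g gh; apply: lhom_ext => v; apply: hhomBB_ext => x y.
rewrite transpose_funE -gh /= tmapE [RHS]hom_eval_funE lfun_act [RHS]homlactE.
by rewrite amul1l.
Qed.

(** As [1 ⊗ 1] is coinvariant, so is [f (1 ⊗ 1)], and [eta] sends it to [[f (1 ⊗ 1)] ⊗ 1]. The
    factor [b] is restored by right linearity. *)
Lemma free_hom_sigma (M : hopfmod B) :
  free_hom (sigma M) = hhom_comp (overline_eta M) (hom_eval M).
Proof.
apply/hhom_ext/tens_ext2 => f b /=.
rewrite tmapE [X in overline_eta_fun X]hom_eval_funE -[in RHS](amul1l b).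
rewrite -[X in f X](free_hrE (V := regular_lmodule B)) -/(hr BB _ _) hfun_r.
rewrite [RHS]overline_eta_r.
rewrite /overline_eta_fun hfun_delta.
have -> : delta BB (aone ⊗ aone) = (aone ⊗ aone) ⊗ (aone : B).
  by rewrite /= tmapE /= comul1 tassocVE.
by rewrite !tmapE [RHS]free_hrE amul1l.
Qed.

Lemma frobenius_sigma_iso (M : hopfmod B) : is_frobenius F ->
  @is_iso (lmodule_cat B) (hom_lmodule M) (overline_lmodule M) (sigma M).
Proof.
move=> F_frob; apply: (frobenius_unit_counit_iso (@free_functor_faithful k B)
  (@free_functor_full k B) F_frob (@overline_eta_universal k B M)
  (@hom_eval_universal M)).
exact: free_hom_sigma.
Qed.
End HomCounit.

(** * Strong monoidality *)

Section Phi.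
Variables (k : comPzRingType) (B : bialgType k).
Implicit Types (V W : lmodule B).

Section Iso.
Variables V W : lmodule B.
Local Notation FV := (free_hopfmod V).
Local Notation FW := (free_hopfmod W).
Local Notation FVW := (free_hopfmod (lmodule_tens V W)).
Local Notation bt := (btens (hr FV) (hl FW)).

Definition free_phiV_pure (v : V) (y : FW) : hopfmod_tens FV FW :=
  bt (v ⊗ aone) y.
Lemma free_phiV_pure_l y : linear (free_phiV_pure ^~ y).
Proof. by move=> c v w; rewrite /free_phiV_pure !(bilinDl, bilinZl). Qed.
Lemma free_phiV_pure_r v : linear (free_phiV_pure v).
Proof. by move=> c x y; rewrite /free_phiV_pure bilinDr bilinZr. Qed.
HB.instance Definition _ := isBilin.Build k V FW (hopfmod_tens FV FW)
  free_phiV_pure free_phiV_pure_l free_phiV_pure_r.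
Definition free_phiV : {linear FVW -> hopfmod_tens FV FW} :=
  tlift free_phiV_pure \o tassoc.

(** [(v ⊗ a) ⊗_B y = (v ⊗ 1) ⊗_B a y]. *)
Lemma free_phiK : cancel (free_phi V W) free_phiV.
Proof.
move=> x; btens_elim x => x y; tens_elim x => v a.
rewrite [free_phi V W _]free_phi_funE free_phi_pureE /= tassocVK tliftE /=.
by rewrite /free_phiV_pure -btens_bal [X in bt X _]free_hrE amul1l.
Qed.
Lemma free_phiVK : cancel free_phiV (free_phi V W).
Proof.
move=> x; tens_elim x => x b; tens_elim x => v w.
rewrite /= tassocE tliftE [LHS]free_phi_funE free_phi_pureE hl1.
exact: tassocVE.
Qed.
Lemma free_phi_iso :
  @is_iso (hopfmod_cat B) (hopfmod_tens FV FW) FVW (free_phi V W).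
Proof. exact: hhom_iso free_phiK free_phiVK. Qed.
End Iso.

Lemma free_phi0_iso : @is_iso (hopfmod_cat B) (hopfmod_unit B)
  (free_hopfmod (lmodule_unit B)) (free_phi0 B).
Proof. exact: (@hhom_iso k B _ _ (free_phi0 B) (@tlunit k B)
  (@tlunitVK k B (regular_lmodule B)) (@tlunitK k B (regular_lmodule B))). Qed.

Lemma free_phi_nat V V' W W' (f : lmodule_hom V V') (g : lmodule_hom W W') :
  hhom_comp (free_phi V' W') (hhom_tens (free_hom f) (free_hom g)) =
  hhom_comp (free_hom (lhom_tens f g)) (free_phi V W).
Proof.
apply/hhom_ext/btens_ext2 => x y /=.
rewrite [X in free_phi_fun X]btmapE !free_phi_funE.
tens_elim x => v a; rewrite /= tmapE /= !free_phi_pureE -free_hom_l.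
by move: (hl _ a y) => z; tens_elim z => w b; tsimp.
Qed.

Lemma free_phi_assoc U V W :
  hhom_comp (free_hom (lhom_assoc U V W))
    (hhom_comp (free_phi (lmodule_tens U V) W)
      (hhom_tens (free_phi U V) (hhom_id (free_hopfmod W)))) =
  hhom_comp (free_phi U (lmodule_tens V W))
    (hhom_comp (hhom_tens (hhom_id (free_hopfmod U)) (free_phi V W))
      (hhom_assoc (free_hopfmod U) (free_hopfmod V) (free_hopfmod W))).
Proof.
apply/hhom_ext/hopfmod_ext3 => x y z /=.
rewrite btassocE !btmapE /= !free_phi_funE.
tens_elim x => u a; rewrite !free_phi_pureE -[free_phi_pure y z]free_phi_funE.
(* Left linearity of [phi] moves [a] onto [y]; then [a y] may be replaced by an arbitrary pure
   tensor. *)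
rewrite -free_phi_l [X in free_phi_fun X]bt_hlE free_phi_funE.
move: (hl _ a y) => {}y; tens_elim y => v b.
rewrite tassocVE !free_phi_pureE.
by move: (hl _ b z) => {}z; tens_elim z => w c; tsimp.
Qed.

Lemma free_phi_lunit V :
  hhom_comp (free_hom (lhom_lunit V)) (hhom_comp (free_phi (lmodule_unit B) V)
    (hhom_tens (free_phi0 B) (hhom_id (free_hopfmod V)))) =
  hhom_lunit (free_hopfmod V).
Proof.
apply/hhom_ext/btens_ext2 => b y.
rewrite [RHS]btlunitE [LHS]/= btmapE free_phi_funE /tensl free_phi_pureE.
move: (hl (free_hopfmod V) b y) => z.
by tens_elim z => v c; tsimp; rewrite scale1r.
Qed.

Lemma free_phi_runit V :
  hhom_comp (free_hom (lhom_runit V)) (hhom_comp (free_phi V (lmodule_unit B))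
    (hhom_tens (hhom_id (free_hopfmod V)) (free_phi0 B))) =
  hhom_runit (free_hopfmod V).
Proof.
apply/hhom_ext/btens_ext2 => x b /=.
rewrite btmapE [RHS]btrunitE /= free_phi_funE.
tens_elim x => v a; rewrite free_phi_pureE -free_phi0_l /tensl tassocVE tmapE.
by rewrite /= trunitE scale1r bilinrE.
Qed.

Lemma free_functor_strong_monoidal :
  @strong_monoidal (lmodule_moncat B) (hopfmod_moncat B)
    (free_functor B) (@free_phi k B) (free_phi0 B).
Proof.
split.
- exact: free_phi_iso.
- exact: free_phi0_iso.
- by move=> V V' W W' f g; exact: free_phi_nat.
- exact: free_phi_assoc.
- exact: free_phi_lunit.
- exact: free_phi_runit.
Qed.
End Phi.

(** * The antipode inverts the unit *)

Section PartialApplication.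
Variables (k : comPzRingType) (U V W : lmodType k) (f : {bilin U -> V -> W}).
Definition bilapp (u : U) (v : V) : W := f u v.
HB.instance Definition _ u :=
  GRing.isLinear.Build k V W _ (bilapp u) (bilin_r_subproof (s := f) u).
End PartialApplication.

Lemma comulVA (k : comPzRingType) (B : bialgType k) (b : B) :
  tassocV (tmap idfun comul (comul b)) = tmap comul idfun (comul b).
Proof. by rewrite -comulA tassocK. Qed.

Section Antipode.
Variables (k : comPzRingType) (B : bialgType k) (S : {linear B -> B}).
Hypothesis S_antipode : is_antipode S.

Lemma antipode_l (b : B) :
  tlift amul (tmap S idfun (comul b)) = (counit b : k) *: aone.
Proof. by case: (S_antipode b). Qed.
Lemma antipode_r (b : B) :
  tlift amul (tmap idfun S (comul b)) = (counit b : k) *: aone.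
Proof. by case: (S_antipode b). Qed.

(* h(x ⊗ 1) = h(x_1 ⊗ x_2 S(x_3)) = h(x_1 ⊗ x_2) S(x_3) = u S(x) *)
Lemma antipode_convolution (h : {linear (B ⊗ B)%type -> B}) (u : B) :
  (forall x y z, h (x ⊗ y) ∙ z = h (x ⊗ (y ∙ z))) ->
  (forall x, h (comul x) = (counit x : k) *: u) ->
  forall x, h (x ⊗ aone) = u ∙ S x.
Proof.
move=> h_r h_comul x.
transitivity (tlift amul (tmap h S (tassocV (tmap idfun comul (comul x))))).
  rewrite -[in LHS](counitr x); move: (comul x) => t; tens_elim t => b c; tsimp.
  rewrite bilinZl -bilinZr -antipode_r.
  by move: (comul c) => t; tens_elim t => d e; tsimp; rewrite !tliftE h_r.
rewrite comulVA tmap_comp -[in RHS](counitl x).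
move: (comul x) => t; tens_elim t => b c; tsimp.
by rewrite tliftE h_comul linearZ bilinZl bilinZr.
Qed.

(** The convolution lemma is applied to [h (x ⊗ y) = S(a_1 x) a_2 y]: on [comul x] this is the
    antipode axiom for [a x], with value [eps(a) eps(x) 1]. *)
Lemma antipode_mul_cancel (a b : B) :
  tlift amul (tmap (S \o bilflip amul b) idfun (comul a)) =
  (counit a : k) *: S b.
Proof.
pose h := tlift amul \o
  (tmap S idfun \o bilapp (tbil (@amul k B) (@amul k B)) (comul a)).
have h_r x y z : h (x ⊗ y) ∙ z = h (x ⊗ (y ∙ z)).
  rewrite /h /= /bilapp; move: (comul a) => t; tens_elim t => c d; tsimp.
  by rewrite !tliftE -!amulA.
have h_comul x : h (comul x) = (counit x : k) *: ((counit a : k) *: aone).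
  by rewrite /h /= /bilapp -comulM antipode_l counitM scalerA mulrC.
have := antipode_convolution h_r h_comul b.
rewrite bilinZl amul1l => <-; rewrite /h /= /bilapp.
move: (comul a) => t; tens_elim t => c d; tsimp.
by rewrite !tliftE amul1r.
Qed.

(** The convolution lemma is applied to [h (x ⊗ y) = S(x b) y] and [u = S(b)]; the cancellation rule
    supplies its hypothesis. *)
Lemma antipodeM (a b : B) : S (a ∙ b) = S b ∙ S a.
Proof.
pose h := tlift amul \o tmap (S \o bilflip (@amul k B) b) (@idfun B).
rewrite -(@antipode_convolution h (S b)).
- by rewrite /h /= tmapE tliftE amul1r.
- by move=> x y z; rewrite /h /= !tmapE !tliftE amulA.
- by move=> x; rewrite -antipode_mul_cancel.
Qed.

(** * The inverse of [eta] *)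

Section UnitIso.
Variable M : hopfmod B.
Local Notation FM := (free_hopfmod (overline_lmodule M)).

(* m |-> m_0 S(m_1) *)
Definition coinv_proj : {linear M -> M} :=
  tlift (hr M) \o (tmap idfun S \o delta M).
(** Antimultiplicativity turns the left side into [m_0 b_1 S(b_2) S(m_1)]. *)
Lemma coinv_proj_r m b : coinv_proj (hr M m b) = (counit b : k) *: coinv_proj m.
Proof.
rewrite /coinv_proj /= delta_r; move: (delta M m) => x.
tens_elim x => n c; tsimp; rewrite [in RHS]tliftE /=.
transitivity (hr M n (tlift amul (tmap idfun S (comul b)) ∙ S c)).
  move: (comul b) => t; tens_elim t => d e; tsimp.
  by rewrite !tliftE /= antipodeM !hrM.
by rewrite antipode_r bilinZl amul1l bilinZr.
Qed.
Lemma coinv_proj_augm x : augm_rel x -> coinv_proj x = 0.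
Proof. by move=> [m [b [b0 ->]]]; rewrite coinv_proj_r b0 scale0r. Qed.
Definition coinv_lift : {linear overline M -> M} := qlift coinv_proj_augm.
Lemma coinv_liftE m : coinv_lift (opi M m) = coinv_proj m.
Proof. exact: qliftE. Qed.

Definition overline_etaV : {linear FM -> M} := tlift (bilpre (hr M) coinv_lift).
Lemma overline_etaVE z b : overline_etaV (z ⊗ b) = hr M (coinv_lift z) b.
Proof. exact: tliftE. Qed.

(** [m_0 S(m_1) m_2 = m]; here [K] is [n ⊗ b ⊗ c |-> n S(b) c], so that coassociativity can be
    applied under it. *)
Lemma overline_etaK : cancel (overline_eta M) overline_etaV.
Proof.
move=> m; rewrite -[RHS]delta_counit.
pose K : {linear (M ⊗ B ⊗ B)%type -> M} :=
  tlift (hr M) \o (tmap idfun (tlift amul \o tmap S idfun) \o tassoc).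
transitivity (K (tmap (delta M) idfun (delta M m))).
  change (overline_etaV (tmap (opi M) idfun (delta M m)) =
    K (tmap (delta M) idfun (delta M m))).
  move: (delta M m) => x; tens_elim x => n b.
  rewrite !tmapE overline_etaVE coinv_liftE /coinv_proj /=.
  move: (delta M n) => y; tens_elim y => p c; tsimp.
  by rewrite !tliftE /= hrM.
rewrite /K /= deltaA; move: (delta M m) => x; tens_elim x => n b; tsimp.
by rewrite tliftE antipode_l bilinZr hr1.
Qed.

(** By right linearity [eta (m_0 S(m_1)) = [m_0] ⊗ m_1 S(m_2)], and the antipode axiom contracts the
    second factor. *)
Lemma overline_eta_coinv_proj m :
  overline_eta M (coinv_proj m) = opi M m ⊗ aone.
Proof.
rewrite -[in RHS](delta_counit m).
pose K : {linear (M ⊗ B ⊗ B)%type -> FM} :=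
  tmap (opi M) (tlift amul \o tmap idfun S) \o (@tassoc k M B B).
transitivity (K (tmap (delta M) idfun (delta M m))).
  rewrite /coinv_proj /=; move: (delta M m) => x; tens_elim x => n b.
  rewrite !tmapE tliftE [LHS]overline_eta_r /overline_eta_fun.
  move: (delta M n) => y; tens_elim y => p c.
  by rewrite tmapE [LHS]bilinrE; tsimp; rewrite tliftE.
rewrite /K /= deltaA; move: (delta M m) => x; tens_elim x => n b; tsimp.
by rewrite antipode_r bilinZr linearZ bilinZl.
Qed.

Lemma overline_etaVK : cancel overline_etaV (overline_eta M).
Proof.
move=> x; tens_elim x => z b; elim/quot_ind: z => m.
rewrite overline_etaVE coinv_liftE hfun_r overline_eta_coinv_proj.
by rewrite [LHS]free_hrE amul1l.
Qed.

Lemma antipode_overline_eta_iso :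
  @is_iso (hopfmod_cat B) M FM (overline_eta M).
Proof. exact: hhom_iso overline_etaK overline_etaVK. Qed.
End UnitIso.

Lemma antipode_equivalence : is_equivalence (free_functor B).
Proof.
exists (overline_functor B); split.
  by exists (@overline_nu k B); split;
    [exact: overline_nu_natural | exact: overline_nu_iso].
(* A natural isomorphism from [F L] to the identity is required, while [eta] points the other way;
   hence its inverses are chosen. *)
pose t M := projT1 (cid (antipode_overline_eta_iso M)).
have tl M := (projT2 (cid (antipode_overline_eta_iso M))).1.
have tr M := (projT2 (cid (antipode_overline_eta_iso M))).2.
exists t; split; first exact: natural_inv (@overline_eta_natural k B) tl tr.
by move=> M; exists (overline_eta M); split; [exact: tr | exact: tl].
Qed.
End Antipode.

(** * The antipode from the inverse of sigma *)

Section DiagonalHopfModule.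
Variables (k : comPzRingType) (B : bialgType k) (N : lmodType k).
Variables (l : {bilin B -> N -> N}) (r : {bilin N -> B -> N}).
Hypotheses (l1 : forall n, l aone n = n)
  (lM : forall a b n, l (a ∙ b) n = l a (l b n))
  (r1 : forall n, r n aone = n)
  (rM : forall n a b, r n (a ∙ b) = r (r n a) b)
  (lr : forall a n b, r (l a n) b = l a (r n b)).

(** Any bimodule [N] makes [N ⊗ B] a Hopf module with both actions diagonal. For [N = B] with
    trivial or regular left action this gives the two structures on [B ⊗ B] to which [sigma] is
    applied. *)
Definition diag_hl : {bilin B -> (N ⊗ B)%type -> (N ⊗ B)%type} :=
  bilpre (tbil l amul) comul.
Definition diag_hr (x : N ⊗ B) (b : B) : N ⊗ B := tbil r amul x (comul b).
Lemma diag_hr_l b : linear (diag_hr ^~ b).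
Proof. by move=> c x y; rewrite /diag_hr bilinDl bilinZl. Qed.
Lemma diag_hr_r x : linear (diag_hr x).
Proof. by move=> c a b; rewrite /diag_hr linearP bilinDr bilinZr. Qed.
HB.instance Definition _ := isBilin.Build k (N ⊗ B)%type B (N ⊗ B)%type
  diag_hr diag_hr_l diag_hr_r.
Definition diag_delta : {linear (N ⊗ B)%type -> (N ⊗ B ⊗ B)%type} :=
  tassocV \o tmap idfun comul.

Lemma diag_hl1 x : diag_hl aone x = x.
Proof.
rewrite /= /bilpre comul1; tens_elim x => n b; tsimp.
by rewrite l1 amul1l.
Qed.
Lemma diag_hlM a b x : diag_hl (a ∙ b) x = diag_hl a (diag_hl b x).
Proof.
rewrite /= /bilpre comulM; apply: tbil_assoc => *; first exact: lM.
by rewrite amulA.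
Qed.
Lemma diag_hr1 x : diag_hr x aone = x.
Proof.
by rewrite /diag_hr comul1; tens_elim x => n b; tsimp; rewrite r1 amul1r.
Qed.
Lemma diag_hrM x a b : diag_hr x (a ∙ b) = diag_hr (diag_hr x a) b.
Proof.
rewrite /diag_hr comulM; apply/esym/tbil_assoc => *; first exact/esym/rM.
by rewrite amulA.
Qed.
Lemma diag_hlr a x b : diag_hr (diag_hl a x) b = diag_hl a (diag_hr x b).
Proof.
by rewrite /diag_hr /= /bilpre; apply: tbil_assoc => *; rewrite ?lr ?amulA.
Qed.

Lemma diag_deltaA x :
  tassoc (tmap diag_delta idfun (diag_delta x)) =
  tmap idfun comul (diag_delta x).
Proof.
tens_elim x => n b; rewrite /= tmapE /=.
transitivity (tassocV (n ⊗ tmap idfun comul (comul b))); last first.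
  by move: (comul b) => t; tens_elim t => b1 b2; tsimp.
rewrite -comulA; move: (comul b) => t; tens_elim t => b1 b2; tsimp.
by move: (comul b1) => t; tens_elim t => b3 b4; tsimp.
Qed.
Lemma diag_delta_counit x : trunit (tmap idfun counit (diag_delta x)) = x.
Proof.
tens_elim x => n b; rewrite /= tmapE /= -[in RHS](counitr b).
move: (comul b) => t; tens_elim t => b1 b2; tsimp.
by rewrite bilinZr.
Qed.
Lemma diag_delta_l a x :
  diag_delta (diag_hl a x) = tbil diag_hl amul (comul a) (diag_delta x).
Proof.
rewrite /diag_delta /= tbil_prel -comulVA -tassocV_tbil; congr tassocV.
by rewrite /bilpre; apply: tmap_tbil => // *; rewrite comulM.
Qed.
Lemma diag_delta_r x b :
  diag_delta (diag_hr x b) = tbil diag_hr amul (diag_delta x) (comul b).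
Proof.
transitivity (tbil (tbil r amul) amul (diag_delta x)
  (tmap comul idfun (comul b))).
  rewrite /diag_delta /= -comulVA -tassocV_tbil; congr tassocV.
  by apply: tmap_tbil => // *; rewrite comulM.
move: (diag_delta x) (comul b) => y t.
by tens_elim y => y c; tens_elim t => b1 b2; tsimp.
Qed.
Lemma diag_delta_act a x b : diag_delta (diag_hr (diag_hl a x) b) =
  tbil diag_hr amul (tbil diag_hl amul (comul a) (diag_delta x)) (comul b).
Proof. by rewrite diag_delta_r diag_delta_l. Qed.

Definition diag_hopfmod : hopfmod B :=
  @HopfModule k B (N ⊗ B)%type diag_hl diag_hr diag_delta diag_hl1 diag_hlM
    diag_hr1 diag_hrM diag_hlr diag_deltaA diag_delta_counit diag_delta_act.

(** Applying [eps] to the middle factor of [N ⊗ B ⊗ B] turns the coaction of [x] back into [x]. *)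
Lemma diag_delta_coinv x : diag_delta x = x ⊗ (aone : B) ->
  x = trunit (tmap idfun counit x) ⊗ (aone : B).
Proof.
pose p : {linear (N ⊗ B)%type -> N} := trunit \o tmap idfun counit.
move=> /(congr1 (tmap p idfun)); rewrite tmapE => <-; apply/esym.
tens_elim x => n b; rewrite /= tmapE -[in RHS](counitl b) /=.
move: (comul b) => t; tens_elim t => b1 b2; tsimp.
by rewrite bilinZl bilinZr.
Qed.

Section HomFree.
Variables (V : lmodule B) (f : hopfmod_hom (free_hopfmod V) diag_hopfmod).
(** Since [v ⊗ 1] is coinvariant, [f (v ⊗ 1)] lies in [N ⊗ 1]; this reads off its first factor, and
    the antipode arises in this way. *)
Definition hom_coinv : {linear V -> N} :=
  trunit \o (tmap idfun counit \o (f \o tensr (aone : B))).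
Lemma hom_coinvE v : f (v ⊗ aone) = hom_coinv v ⊗ aone.
Proof.
apply: diag_delta_coinv; rewrite -[LHS]/(delta diag_hopfmod _) hfun_delta.
by rewrite /= tmapE /= comul1 tassocVE tmapE.
Qed.
End HomFree.
End DiagonalHopfModule.

(** * Two Hopf module structures on [B ⊗ B] and maps into them *)

Section SigmaAntipode.
Variables (k : comPzRingType) (B : bialgType k).
Local Notation BB := (free_hopfmod (regular_lmodule B)).

Definition triv_act (a n : B) : B := (counit a : k) *: n.
Lemma triv_act_l n : linear (triv_act ^~ n).
Proof. by move=> c a b; rewrite /triv_act linearP scalerDl -scalerA. Qed.
Lemma triv_act_r a : linear (triv_act a).
Proof. by move=> c x y; rewrite /triv_act linearP. Qed.
HB.instance Definition _ := isBilin.Build k B B B triv_act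
  triv_act_l triv_act_r.
Lemma triv_act1 n : triv_act aone n = n.
Proof. by rewrite /triv_act counit1 scale1r. Qed.
Lemma triv_actM a b n : triv_act (a ∙ b) n = triv_act a (triv_act b n).
Proof. by rewrite /triv_act counitM scalerA. Qed.
Lemma triv_act_amul a n b : triv_act a n ∙ b = triv_act a (n ∙ b).
Proof. by rewrite /triv_act bilinZl. Qed.

Definition triv_hopfmod : hopfmod B :=
  diag_hopfmod triv_act1 triv_actM (@amul1r _ B) (fun n a b => amulA n a b)
    triv_act_amul.
Definition regular_hopfmod : hopfmod B :=
  diag_hopfmod (@amul1l _ B) (fun a b n => esym (amulA a b n)) (@amul1r _ B)
    (fun n a b => amulA n a b) (fun a n b => esym (amulA a n b)).
Local Notation MT := triv_hopfmod.
Local Notation MR := regular_hopfmod.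

Lemma triv_hlE a n b : hl MT a (n ⊗ b) = n ⊗ (a ∙ b).
Proof.
rewrite -{2}[a]counitl /= /bilpre; move: (comul a) => t.
tens_elim t => a1 a2; tsimp.
by rewrite /triv_act bilinZl -bilinZr -bilinZl.
Qed.

Section LeftMul.
Variable c : B.
Lemma triv_lmul_l b x : tmap (bilapp amul c) idfun (hl MT b x) =
  hl MT b (tmap (bilapp amul c) idfun x).
Proof. by tens_elim x => n d; rewrite triv_hlE !tmapE triv_hlE. Qed.
Lemma triv_lmul_r x b : tmap (bilapp amul c) idfun (hr MT x b) =
  hr MT (tmap (bilapp amul c) idfun x) b.
Proof.
rewrite /= /diag_hr -[comul b in RHS]tmap_id; apply: tmap_tbil => // n d.
by rewrite /= /bilapp amulA.
Qed.
Lemma triv_lmul_delta x : delta MT (tmap (bilapp amul c) idfun x) =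
  tmap (tmap (bilapp amul c) idfun) idfun (delta MT x).
Proof.
rewrite /= -tassocV_nat !tmap_comp; congr tassocV; apply: eq_tmap => // b /=.
by rewrite tmap_id.
Qed.
(** The left action of [MT] does not touch the first factor, so left multiplication by [c] there is
    an endomorphism of Hopf modules. *)
Definition triv_lmul : hopfmod_hom MT MT :=
  @HopfmodHom k B MT MT (tmap (bilapp amul c) idfun)
    triv_lmul_l triv_lmul_r triv_lmul_delta.
Lemma triv_lmulE n b : triv_lmul (n ⊗ b) = (c ∙ n) ⊗ b.
Proof. exact: tmapE. Qed.
End LeftMul.

Lemma triv_counit_hr n b :
  trunit (tmap idfun counit (hr MT (n ⊗ aone) b)) = n ∙ b.
Proof.
rewrite -[in RHS](counitr b) /= /diag_hr; move: (comul b) => t.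
tens_elim t => b1 b2; tsimp.
by rewrite amul1l bilinZr.
Qed.

Section Central.
Variable c : B.
Hypothesis c_central : forall b, c ∙ b = b ∙ c.
Local Notation BU := (hopfmod_unit B).
Definition comul_lmul : {linear B -> (B ⊗ B)%type} :=
  tmap (bilapp amul c) idfun \o comul.
(** Centrality moves [c] past [b_1] in [c b_1 x_1 ⊗ b_2 x_2]. *)
Lemma comul_lmul_l b x : comul_lmul (hl BU b x) = hl MR b (comul_lmul x).
Proof.
rewrite /= comulM /bilpre -[comul b in RHS]tmap_id; apply: tmap_tbil => // y z.
by rewrite /= /bilapp !amulA c_central.
Qed.
Lemma comul_lmul_r x b : comul_lmul (hr BU x b) = hr MR (comul_lmul x) b.
Proof.
rewrite /= comulM /diag_hr -[comul b in RHS]tmap_id; apply: tmap_tbil => // y z.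
by rewrite /= /bilapp amulA.
Qed.
Lemma comul_lmul_delta x :
  delta MR (comul_lmul x) = tmap comul_lmul idfun (delta BU x).
Proof.
transitivity (tassocV (tmap (bilapp amul c) (tmap idfun idfun)
  (tmap idfun comul (comul x)))).
  rewrite /= !tmap_comp; congr tassocV.
  by apply: eq_tmap => // b /=; rewrite tmap_id.
by rewrite tassocV_nat comulVA tmap_comp; apply: eq_tmap.
Qed.
Definition comul_lmul_hom : hopfmod_hom BU MR :=
  @HopfmodHom k B BU MR comul_lmul comul_lmul_l comul_lmul_r comul_lmul_delta.
End Central.

Section Projection.
Local Notation BU := (hopfmod_unit B).
(** This is the free functor applied to the counit [B -> k], followed by the isomorphism of [k ⊗ B]
    with [B]. *)
Definition free_proj : {linear (B ⊗ B)%type -> B} :=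
  tlunit \o tmap counit idfun.
Lemma free_projE x y : free_proj (x ⊗ y) = (counit x : k) *: y.
Proof. by rewrite /free_proj /= tmapE tlunitE. Qed.
Lemma free_proj_l b x : free_proj (hl BB b x) = hl BU b (free_proj x).
Proof.
tens_elim x => y z; rewrite free_projE -[b in RHS]counitl /= /bilpre.
move: (comul b) => t; tens_elim t => b1 b2; tsimp.
by rewrite counitM bilinZl bilinZr scalerA.
Qed.
Lemma free_proj_r x b : free_proj (hr BB x b) = hr BU (free_proj x) b.
Proof.
tens_elim x => y z; rewrite [hr BB _ _]free_hrE !free_projE.
by rewrite [RHS]bilinZl.
Qed.
Lemma free_proj_delta x :
  delta BU (free_proj x) = tmap free_proj idfun (delta BB x).
Proof.
tens_elim x => y z; rewrite free_projE /= tmapE linearZ /=.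
by move: (comul z) => t; tens_elim t => b1 b2; tsimp; rewrite bilinZl.
Qed.
Definition free_proj_hom : hopfmod_hom BB BU :=
  @HopfmodHom k B BB BU free_proj free_proj_l free_proj_r free_proj_delta.
End Projection.

(** * The antipode axioms *)

Section SigmaIso.
Hypothesis sigma_iso : forall M : hopfmod B,
  @is_iso (lmodule_cat B) (hom_lmodule M) (overline_lmodule M) (sigma M).

Lemma sigma_iso_bij (M : hopfmod B) :
  injective (sigma M) /\ forall z, exists f, sigma M f = z.
Proof.
have [g [gs sg]] := sigma_iso M; split=> [f f' e|z].
  rewrite -[f]/(lhom_id _ f) -[f']/(lhom_id _ f').
  by rewrite -[lhom_id _]gs /= e.
by exists ((g : lmodule_hom _ _) z);
  move/(congr1 (fun h : lmodule_hom _ _ => h z)): sg.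
Qed.

Section Candidate.
Variable f : hopfmod_hom BB MT.
Hypothesis f_unit : sigma_fun (M := MT) f = opi MT (aone ⊗ aone).
Local Notation S := (hom_coinv f).
Local Notation e := (S aone).

(** Computing [f (a (1 ⊗ 1))] in two ways gives [e ⊗ a = f (a_1 ⊗ a_2) = (S(a_1) ⊗ 1) a_2]; then
    [eps] is applied to the second factor. *)
Lemma candidate_l a : tlift amul (tmap S idfun (comul a)) = (counit a : k) *: e.
Proof.
have := congr1 (trunit \o tmap idfun counit) (hfun_l f a (aone ⊗ aone)).
rewrite hom_coinvE triv_hlE amul1r /= tmapE trunitE /= => <-.
rewrite /bilpre; move: (comul a) => t; tens_elim t => b c.
rewrite tbilE /= !amul1r tmapE tliftE -triv_counit_hr -hom_coinvE -hfun_r.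
by rewrite [hr BB _ _]free_hrE amul1l.
Qed.

Lemma candidate_sigma (t : B ⊗ B) : exists g : hopfmod_hom BB MT,
  g (aone ⊗ aone) = tlift amul (tmap idfun S t) ⊗ aone /\
  sigma_fun (M := MT) g = opi MT t.
Proof.
elim/tens_ind: t => [|c d|x y [g [g1 gs]] [h [h1 hs]]].
- exists (0 : hom_lmodule MT); split; first by rewrite !lin0E.
  by rewrite !linear0.
(* This map sends [1 ⊗ 1] to [c f (d ⊗ 1) = c S(d) ⊗ 1], where [c] multiplies the first factor, and
   linearity of [sigma] gives it the value [[c ⊗ d]]. *)
- exists (hhom_comp (triv_lmul c) (homlact d f)).
  have E : homlact d f (aone ⊗ aone) = f (d ⊗ aone) by rewrite homlactE amul1l.
  split.
    by rewrite [LHS]/= [X in tmap _ _ X]E hom_coinvE !tmapE tliftE.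
  have := sigma_act d (f : hom_lmodule MT).
  rewrite f_unit [RHS]olactE triv_hlE amul1r => h.
  have := congr1 (overline_hom_fun (triv_lmul c)) h.
  rewrite /sigma_fun !overline_hom_funE triv_lmulE amul1r; exact.
- exists ((g : hom_lmodule MT) + (h : hom_lmodule MT)); split.
    by rewrite hhom_addE g1 h1 !linDE.
  by rewrite linearD /= gs hs linearD.
Qed.

(** In the quotient of [MT], [[a_1 ⊗ a_2] = [(1 ⊗ 1) a] = eps(a) [1 ⊗ 1]]. So the map [g] built from
    [comul a] and [eps(a) f] have the same image under [sigma]; by injectivity they agree at
    [1 ⊗ 1]. *)
Lemma candidate_r a : tlift amul (tmap idfun S (comul a)) = (counit a : k) *: e.
Proof.
have [g [g1 gs]] := candidate_sigma (comul a).
have gE : (g : hom_lmodule MT) = (counit a : k) *: (f : hom_lmodule MT).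
  apply: (sigma_iso_bij MT).1; rewrite linearZ [LHS]gs /= f_unit -opi_hr.
  congr (opi MT _); apply/esym; rewrite /= /diag_hr.
  by move: (comul a) => t; tens_elim t => b c; rewrite tbilE /= !amul1l.
have := g1; rewrite gE hhom_scalerE hom_coinvE -bilinZl.
move/(congr1 (trunit \o tmap idfun counit)) => /=.
by rewrite !tmapE !trunitE counit1 !scale1r.
Qed.

(* a e = a_1 S(a_2) a_3 = e a *)
Lemma candidate_unit_central a : e ∙ a = a ∙ e.
Proof.
transitivity (tlift amul (tmap (tlift amul \o tmap idfun S) idfun
  (tassocV (tmap idfun comul (comul a))))).
  rewrite comulVA tmap_comp -[in LHS](counitl a).
  move: (comul a) => t; tens_elim t => b c; tsimp.
  by rewrite tliftE candidate_r /= bilinZl bilinZr.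
rewrite -[in RHS](counitr a).
move: (comul a) => t; tens_elim t => b c; tsimp.
rewrite bilinZl -bilinZr -candidate_l.
move: (comul c) => t; tens_elim t => b1 b2; tsimp.
by rewrite !tliftE /= amulA.
Qed.

(** The equation [sigma f = [1 ⊗ 1]] says [[e ⊗ 1] = [1 ⊗ 1]]. Centrality of [e] lets both classes
    be realised as [sigma]-values of maps into [MR], and injectivity lifts the equality to
    [e ⊗ 1 = 1 ⊗ 1]. *)
Lemma candidate_unit : e = aone.
Proof.
have one_central (b : B) : aone ∙ b = b ∙ aone by rewrite amul1l amul1r.
pose g c (cP : forall b : B, c ∙ b = b ∙ c) : hom_lmodule MR :=
  hhom_comp (comul_lmul_hom cP) free_proj_hom.
have gE c (cP : forall b : B, c ∙ b = b ∙ c) :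
    (g c cP : hopfmod_hom BB MR) (aone ⊗ aone) = c ⊗ aone.
  by rewrite /= !tmapE tlunitE counit1 scale1r comul1 tmapE /= /bilapp amul1r.
have opi_unit : opi MT (e ⊗ aone) = opi MT (aone ⊗ aone).
  by rewrite -f_unit /sigma_fun hom_coinvE.
have : g _ candidate_unit_central = g _ one_central.
  apply: (sigma_iso_bij MR).1; rewrite /= /sigma_fun !gE.
  (* [MT] and [MR] have the same right action, hence the same [M B^+] *)
  by apply/qpiP; move/qpiP: opi_unit.
move/(congr1 (fun h : hopfmod_hom BB MR => h (aone ⊗ aone))).
rewrite !gE => /(congr1 (trunit \o tmap idfun counit)) /=.
by rewrite !tmapE !trunitE counit1 !scale1r.
Qed.
End Candidate.

Lemma sigma_iso_antipode : is_Hopf_algebra B.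
Proof.
(* Surjectivity of [sigma] at [MT] provides the map whose restriction to [B ⊗ 1] is the antipode. *)
have [f f_unit] : exists f : hopfmod_hom BB MT,
    sigma_fun (M := MT) f = opi MT (aone ⊗ aone).
  exact: (sigma_iso_bij MT).2 (opi MT (aone ⊗ aone)).
exists (hom_coinv f) => b.
by rewrite candidate_l // candidate_r // (candidate_unit f_unit).
Qed.
End SigmaIso.
End SigmaAntipode.

Theorem theorem2p12 (k : comPzRingType) (B : bialgType k) :
  [<-> (* (1) *) is_Hopf_algebra B;
       (* (2) *) @is_monoidal_equivalence (lmodule_moncat B) (hopfmod_moncat B)
                   (free_functor B) (@free_phi k B) (free_phi0 B);
       (* (3) *) is_frobenius (free_functor B);
       (* (4) *) forall M : hopfmod B,
                   @is_iso (lmodule_cat B) (hom_lmodule M) (overline_lmodule M)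
                     (sigma M)].
Proof.
tfae.
- move=> [S S_antipode]; split; first exact: free_functor_strong_monoidal.
  exact: antipode_equivalence S_antipode.
- by move=> [_ F_equiv]; apply: equivalence_frobenius.
- by move=> F_frob M; apply: frobenius_sigma_iso.
- exact: sigma_iso_antipode.
Qed.
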